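(* Let $(X,d)$ be a path-connected compact metric space, $x_0\in X$, and $n\geq 1$. Then the topology on $\pi_n(X,x_0)$ induced by the pseudometric $\rho$ is at least as fine as the shape topology on $\pi_n(X,x_0)$. Moreover, these two topologies agree in each of the following two cases: (1) $X$ is $LC^{n-1}$; (2) $X$ is homeomorphic to an inverse limit $\varprojlim_{j\in\mathbb{N}}(X_j,r_{j+1,j})$ of finite polyhedra $X_j$ in which every bonding map $r_{j+1,j}:X_{j+1}\to X_j$ is a retraction.
   Context: $\Omega^n(X,x_0)$ denotes the set of continuous maps $\alpha:[0,1]^n\to X$ with $\alpha(\partial[0,1]^n)=\{x_0\}$, equipped with the uniform metric $\mu(\alpha,\beta)=\sup_{t\in[0,1]^n}d(\alpha(t),\beta(t))$. For $a,b\in\pi_n(X,x_0)$ (homotopy classes of such maps), $\rho(a,b)=\inf\{\mu(\alpha,\beta)\mid \alpha\in a,\beta\in b\}$; this is a pseudometric on $\pi_n(X,x_0)$, and the topology it induces is generated by its open balls. Shape topology: let $\mathrm{cov}(X)$ be the set of pairs $(\mathscr{U},U_0)$ where $\mathscr{U}$ is a locally finite open cover of $X$ and $U_0\in\mathscr{U}$ contains $x_0$, directed by refinement. For such a pair let $|N(\mathscr{U})|$ be the geometric realization of the nerve of $\mathscr{U}$ (vertices are elements of $\mathscr{U}$; finitely many vertices span a simplex iff their intersection is nonempty). Choosing a partition of unity $\{\phi_U\}_{U\in\mathscr{U}}$ subordinate to $\mathscr{U}$ with $\phi_{U_0}(x_0)=1$ gives a canonical map $p_{\mathscr{U}}:(X,x_0)\to(|N(\mathscr{U})|,U_0)$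 sending $x$ to the point with barycentric coordinates $\phi_U(x)$. The shape topology on $\pi_n(X,x_0)$ is the group topology in which the subgroups $\ker(p_{\mathscr{U}\#}:\pi_n(X,x_0)\to\pi_n(|N(\mathscr{U})|,U_0))$, $(\mathscr{U},U_0)\in\mathrm{cov}(X)$, form a neighborhood base of the identity (equivalently, the initial topology with respect to the canonical homomorphism $\Psi_n$ to the $n$-th shape homotopy group $\check{\pi}_n(X,x_0)=\varprojlim \pi_n(|N(\mathscr{U})|,U_0)$, an inverse limit of discrete groups). A space $Y$ is $LC^{m}$ if for every point $y\in Y$ and every neighborhood $U$ of $y$ there is a neighborhood $V\subseteq U$ of $y$ such that for all $0\leq k\leq m$ every map $S^k\to V$ extends to a map $D^{k+1}\to U$. *)

(* Defs.v *)
From HB Require Import structures.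
From mathcomp Require Import all_boot all_order all_algebra.
From mathcomp Require Import all_classical all_reals all_analysis.
Set Implicit Arguments. Unset Strict Implicit. Unset Printing Implicit Defensive.
Import Order.TTheory GRing.Theory Num.Theory.
Import numFieldNormedType.Exports.
Local Open Scope classical_set_scope.
Local Open Scope ring_scope.

Section Defs.
Context {R : realType}.

Definition cube (n : nat) : set 'rV[R]_n :=
  [set t | forall i, 0 <= t ord0 i <= 1].
Definition cube_boundary (n : nat) : set 'rV[R]_n :=
  [set t | cube t /\ exists i, t ord0 i = 0 \/ t ord0 i = 1].

Definition unit_interval : set R := [set s | 0 <= s <= 1].

Definition sphere (k : nat) : set 'rV[R]_k.+1 :=
  [set v | \sum_i (v ord0 i) ^+ 2 = 1].
Definition disk (k : nat) : set 'rV[R]_k.+1 :=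
  [set v | \sum_i (v ord0 i) ^+ 2 <= 1].

Definition htp_rel {T : topologicalType} (S : set T) (y0 : T) (n : nat)
  (f g : 'rV[R]_n -> T) : Prop :=
  exists H : R * 'rV[R]_n -> T,
    {within [set p | unit_interval p.1 /\ cube p.2], continuous H} /\
    (forall p, unit_interval p.1 -> cube p.2 -> S (H p)) /\
    (forall t, cube t -> H (0, t) = f t) /\
    (forall t, cube t -> H (1, t) = g t) /\
    (forall s t, unit_interval s -> cube_boundary t -> H (s, t) = y0).

Definition Omega {X : topologicalType} (x0 : X) (n : nat)
  (a : 'rV[R]_n -> X) : Prop :=
  {within @cube n, continuous a} /\ (forall t, cube_boundary t -> a t = x0).

Definition htp_class {X : topologicalType} (x0 : X) (n : nat)
  (a : 'rV[R]_n -> X) : set ('rV[R]_n -> X) :=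
  [set b | Omega x0 b /\ htp_rel setT x0 a b].

Definition pin {X : topologicalType} (x0 : X) (n : nat) :=
  {A : set ('rV[R]_n -> X) | exists a, Omega x0 a /\ A = htp_class x0 a}.

Definition mu {X : metricType R} (n : nat) (a b : 'rV[R]_n -> X) : R :=
  sup [set mdist (a t) (b t) | t in @cube n].

Definition rho {X : metricType R} (x0 : X) (n : nat) (a b : pin x0 n) : R :=
  inf [set r | exists al be, sval a al /\ sval b be /\ r = mu al be].

Definition rho_open {X : metricType R} (x0 : X) (n : nat)
  (A : set (pin x0 n)) : Prop :=
  forall a, A a -> exists2 e : R, 0 < e & forall b, rho a b < e -> A b.

(** geometric realization of an abstract simplicial complex K on the vertex
    set 'I_m (K = set of simplices): points in barycentric coordinates *)
Definition realization (m : nat) (K : set {set 'I_m}) : set 'rV[R]_m :=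
  [set t : 'rV[R]_m | (forall i, 0 <= t ord0 i) /\ \sum_i t ord0 i = 1 /\
           K (finset (fun i : 'I_m => 0 < t ord0 i))].

Definition vertex (m : nat) (i : 'I_m) : 'rV[R]_m := \row_j (j == i)%:R.

Definition simplicial_complex (m : nat) (K : set {set 'I_m}) : Prop :=
  (forall S, K S -> S != finset.set0) /\
  (forall S S' : {set 'I_m}, K S -> S' \subset S -> S' != finset.set0 -> K S').

Definition nerve {X : Type} (m : nat) (U : 'I_m -> set X) : set {set 'I_m} :=
  [set S | S != finset.set0 /\ exists x, forall i, i \in S -> U i x].

(** (U, U_{i0}) is an element of cov(X): an open cover of X, indexed
    injectively by the finite type 'I_m (a locally finite open cover of a
    compact space is finite), with x0 in U_{i0} *)
Definition pointed_cover {X : topologicalType} (x0 : X) (m : nat)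
  (U : 'I_m -> set X) (i0 : 'I_m) : Prop :=
  (forall i, open (U i)) /\ (forall x, exists i, U i x) /\ injective U /\
  U i0 x0.

Definition pou_subordinate {X : topologicalType} (x0 : X) (m : nat)
  (U : 'I_m -> set X) (i0 : 'I_m) (phi : 'I_m -> X -> R) : Prop :=
  (forall i, continuous (phi i)) /\ (forall i x, 0 <= phi i x) /\
  (forall x, \sum_i phi i x = 1) /\
  (forall i, closure [set x | 0 < phi i x] `<=` U i) /\ phi i0 x0 = 1.

Definition canonical_map {X : Type} (m : nat) (phi : 'I_m -> X -> R)
  (x : X) : 'rV[R]_m := \row_i phi i x.

(** b lies in the same fibre as a of p_U# : pi_n(X) -> pi_n(|N(U)|) *)
Definition shape_fibre {X : topologicalType} (x0 : X) (n m : nat)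
  (U : 'I_m -> set X) (i0 : 'I_m) (phi : 'I_m -> X -> R) (a b : pin x0 n) :=
  exists al be, sval a al /\ sval b be /\
    htp_rel (realization (nerve U)) (vertex i0)
      (canonical_map phi \o al) (canonical_map phi \o be).

(** open sets of the shape topology: every point a of A has a basic
    neighbourhood a * ker(p_U#) (= the fibre of p_U# through a) inside A *)
Definition shape_open {X : topologicalType} (x0 : X) (n : nat)
  (A : set (pin x0 n)) : Prop :=
  forall a, A a -> exists m (U : 'I_m -> set X) i0 phi,
    pointed_cover x0 U i0 /\ pou_subordinate x0 U i0 phi /\
    forall b, shape_fibre U i0 phi a b -> A b.

Definition path_connected (X : topologicalType) : Prop :=
  forall x y : X, exists g : R -> X,
    {within unit_interval, continuous g} /\ g 0 = x /\ g 1 = y.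

Definition LC (k : nat) (X : topologicalType) : Prop :=
  forall (y : X) (U : set X), nbhs y U -> exists V : set X,
    nbhs y V /\ V `<=` U /\
    forall l, (l <= k)%N -> forall f : 'rV[R]_l.+1 -> X,
      {within @sphere l, continuous f} -> f @` @sphere l `<=` V ->
      exists g : 'rV[R]_l.+1 -> X,
        {within @disk l, continuous g} /\ g @` @disk l `<=` U /\
        (forall v, @sphere l v -> g v = f v).

(** X is homeomorphic to an inverse limit of finite polyhedra
    X_j = |K_j| with bonding maps r_j : X_{j+1} -> X_j that are retractions
    (i.e. admit a continuous section s_j). *)
Definition inv_limit_retract_polyhedra (X : topologicalType) : Prop :=
  exists (m : nat -> nat) (K : forall j, set {set 'I_(m j)})
    (r : forall j, 'rV[R]_(m j.+1) -> 'rV[R]_(m j))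
    (s : forall j, 'rV[R]_(m j) -> 'rV[R]_(m j.+1)),
    (forall j, simplicial_complex (K j)) /\
    (forall j, {within realization (K j.+1), continuous r j} /\
               r j @` realization (K j.+1) `<=` realization (K j)) /\
    (forall j, {within realization (K j), continuous s j} /\
               s j @` realization (K j) `<=` realization (K j.+1) /\
               (forall t, realization (K j) t -> r j (s j t) = t)) /\
    let P := prod_topology (fun j => 'rV[R]_(m j)) in
    let L : set P := [set y | forall j, realization (K j) (y j) /\
                                        r j (y j.+1) = y j] in
    exists (h : X -> P) (g : P -> X),
      continuous h /\ (forall x, L (h x)) /\ (forall x, g (h x) = x) /\
      (forall y, L y -> h (g y) = y) /\ {within L, continuous g}.

End Defs.

(* Main.v *)
Require Import Defs.
From HB Require Import structures.
From mathcomp Require Import all_boot all_order all_algebra.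
From mathcomp Require Import all_classical all_reals all_analysis.
From mathcomp Require Import ring lra.
Import Order.TTheory GRing.Theory Num.Theory.
Import numFieldNormedType.Exports.
Local Open Scope classical_set_scope.
Local Open Scope ring_scope.
Set Implicit Arguments. Unset Strict Implicit. Unset Printing Implicit Defensive.

(** If two loops are uniformly close, the segment between their images under
    a partition of unity stays in the nerve, by a Lebesgue number argument.

    Conversely, call two classes e-close if they have representatives at
    pointwise distance < e.  This relation is transitive: if a ~ b up to e and
    b ~ c up to e, realized by (a', b') and (b'', c'), then a' b'^-1 b'' and
    b' b'^-1 c' are e-close representatives of a and c.  So it suffices to join
    two loops with homotopic images in a fine nerve by a chain of e-close loops.

    If X is LC^(n-1), sample the homotopy in the nerve on a fine grid and pick
    for each grid point a point of a cover member on which the corresponding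
    barycentric coordinate is large.  On each horizontal slice these values
    extend over the skeleta of the n-dimensional grid, and neighbouring slices
    are e-close.

    If X is an inverse limit of polyhedra with retractions, a late stage K gives
    maps q : X -> K and f : K -> X with f q e-close to the identity.  The affine
    map sending a vertex U of the nerve to q(y_U), y_U in U, is pushed into K
    and then mapped to X by f; applied to the homotopy it joins loops e-close to
    the given ones.  The base point is first moved, along a path, to the image
    under f of a vertex of K, since f need not meet x0. *)

(** * Continuity and loops on R^n *)

Section Continuity.
Context {R : realType}.
Implicit Types (T U V : topologicalType).

Lemma cts_comp T U V (f : T -> U) (g : U -> V) :
  continuous f -> continuous g -> continuous (fun x => g (f x)).
Proof. by move=> cf cg x; apply: continuous_comp; [exact: cf|exact: cg]. Qed.

Lemma cts_pair T U V (f : T -> U) (g : T -> V) :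
  continuous f -> continuous g -> continuous (fun x => (f x, g x)).
Proof. by move=> cf cg x; apply: cvg_pair; [exact: cf|exact: cg]. Qed.

Lemma cts_fst U V : continuous (fun p : U * V => p.1).
Proof. by move=> p; exact: cvg_fst. Qed.

Lemma cts_snd U V : continuous (fun p : U * V => p.2).
Proof. by move=> p; exact: cvg_snd. Qed.

Lemma cts_row T (n : nat) (f : 'I_n -> T -> R) :
  (forall j, continuous (f j)) -> continuous (fun p => \row_j f j p).
Proof.
move=> cf p A [P fP PA]; rewrite /nbhs /=.
have : \forall q \near p, forall i, P ord0 i (f i q).
  apply: filter_forall => i; apply: (cf i p).
  by have := fP ord0 i; rewrite mxE.
by apply: filterS => q Pq; apply: PA => i j; rewrite (ord1 i) mxE; exact: Pq.
Qed.

Lemma cts_coord T (n : nat) (f : T -> 'rV[R]_n) j :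
  continuous f -> continuous (fun p => f p ord0 j).
Proof.
move=> cf; apply: (@cts_comp _ _ _ f (fun M : 'rV[R]_n => M ord0 j) cf).
exact: coord_continuous.
Qed.

Lemma ctsD T (f g : T -> R) :
  continuous f -> continuous g -> continuous (fun x => f x + g x).
Proof. by move=> cf cg x; apply: cvgD; [exact: cf|exact: cg]. Qed.

Lemma ctsN T (f : T -> R) : continuous f -> continuous (fun x => - f x).
Proof. by move=> cf x; apply: cvgN; exact: cf. Qed.

Lemma ctsM T (f g : T -> R) :
  continuous f -> continuous g -> continuous (fun x => f x * g x).
Proof. by move=> cf cg x; apply: cvgM; [exact: cf|exact: cg]. Qed.

Lemma ctsV T (f : T -> R) :
  (forall x, f x != 0) -> continuous f -> continuous (fun x => (f x)^-1).
Proof. by move=> f0 cf x; apply: cvgV; [exact: f0|exact: cf]. Qed.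

Lemma cts_cst T U (c : U) : continuous (fun _ : T => c).
Proof. by move=> x; exact: cvg_cst. Qed.

Lemma cts_id T : continuous (fun x : T => x).
Proof. by move=> x; exact: cvg_id. Qed.

Lemma cts_norm T (V : normedModType R) (f : T -> V) :
  continuous f -> continuous (fun x => `|f x|).
Proof. by move=> cf x; apply: cvg_norm; exact: cf. Qed.

Lemma cts_max T (f g : T -> R) :
  continuous f -> continuous g -> continuous (fun x => Num.max (f x) (g x)).
Proof.
move=> cf cg; under eq_fun do rewrite maxr_absE.
apply: ctsM; last exact: cts_cst.
apply: ctsD; first exact: ctsD.
by apply: (@cts_norm _ R^o); apply: ctsD => //; apply: ctsN.
Qed.

Lemma cts_min T (f g : T -> R) :
  continuous f -> continuous g -> continuous (fun x => Num.min (f x) (g x)).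
Proof.
move=> cf cg; under eq_fun do rewrite -[Num.min _ _]opprK oppr_min.
by apply: ctsN; apply: cts_max; apply: ctsN.
Qed.

Lemma cts_sum T (I : Type) (r : seq I) (P : pred I) (f : I -> T -> R) :
  (forall i, continuous (f i)) -> continuous (fun x => \sum_(i <- r | P i) f i x).
Proof.
move=> cf; elim: r => [|i r IH].
  by under eq_fun do rewrite big_nil; exact: cts_cst.
under eq_fun do rewrite big_cons.
by case: (P i) => //; apply: ctsD.
Qed.

Lemma closed_le T (f g : T -> R) :
  continuous f -> continuous g -> closed [set x | f x <= g x].
Proof.
move=> cf cg; rewrite (_ : mkset _ = (fun x => g x - f x) @^-1` [set y | 0 <= y]).
  apply: closed_comp; last exact: closed_ge.
  by move=> x _; apply: ctsD => //; apply: ctsN.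
by apply/seteqP; split => x /=; rewrite subr_ge0.
Qed.

Lemma open_lt T (f g : T -> R) :
  continuous f -> continuous g -> open [set x | f x < g x].
Proof.
move=> cf cg.
rewrite (_ : mkset _ = ~` [set x | g x <= f x]).
  by apply: closed_openC; exact: closed_le.
by apply/seteqP; split => x /=; rewrite ltNge => /negP.
Qed.

Lemma within_eq T U (A : set T) (f g : T -> U) :
  (forall x, A x -> f x = g x) -> {within A, continuous f} ->
  {within A, continuous g}.
Proof.
move=> fg; apply: subspace_eq_continuous => x; rewrite inE => Ax.
by rewrite /from_subspace fg.
Qed.

Lemma cts_paste T U (u v : T -> R) (f g : T -> U) :
  continuous u -> continuous v -> continuous f -> continuous g ->
  (forall x, u x = v x -> f x = g x) ->
  continuous (fun x => if u x <= v x then f x else g x).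
Proof.
move=> cu cv cf cg fg.
set h := (fun x => _).
have : {within [set x | u x <= v x] `|` [set x | v x <= u x], continuous h}.
  apply: withinU_continuous; [exact: closed_le|exact: closed_le| |].
    apply: (@within_eq _ _ _ f); last exact: continuous_subspaceT.
    by move=> x /= uv; rewrite /h uv.
  apply: (@within_eq _ _ _ g); last exact: continuous_subspaceT.
  move=> x /= vu; rewrite /h; case: ifPn => // uv.
  by rewrite fg//; apply/eqP; rewrite eq_le uv vu.
rewrite (_ : _ `|` _ = setT); last first.
  by apply/seteqP; split => // x _ /=; apply/orP; exact: le_total.
by rewrite continuous_subspace_setT.
Qed.

Lemma within_cts_comp T U V (A : set U) (f : T -> U) (g : U -> V) :
  continuous f -> (forall x, A (f x)) -> {within A, continuous g} ->
  continuous (fun x => g (f x)).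
Proof.
move=> cf fA /subspace_continuousP cg x W nW.
have nW' : nbhs (f x) [set y | A y -> W (g y)] := cg _ (fA x) W nW.
by have := cf x _ nW'; apply: (@filterS _ (nbhs x)) => y; apply.
Qed.

(** Composing with this retraction of the line onto the unit interval turns data given on an
    interval or a cube into globally continuous maps. *)
Definition clip (x : R) : R := Num.max 0 (Num.min 1 x).

Lemma clip_itv x : 0 <= clip x <= 1.
Proof. by rewrite /clip le_max lexx/= ge_max ler01 ge_min lexx. Qed.

Lemma clip_id x : 0 <= x <= 1 -> clip x = x.
Proof. by move=> /andP[x0 x1]; rewrite /clip (min_idPr x1) (max_idPr x0). Qed.

Lemma clip_le0 x : x <= 0 -> clip x = 0.
Proof. by move=> x0; rewrite /clip; apply/max_idPl; rewrite ge_min x0 orbT. Qed.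

Lemma clip_ge1 x : 1 <= x -> clip x = 1.
Proof. by move=> x1; rewrite /clip (min_idPl x1); apply/max_idPr/ler01. Qed.

Lemma cts_clip : continuous clip.
Proof.
rewrite /clip; apply: cts_max; [exact: cts_cst|apply: cts_min].
  exact: cts_cst.
exact: cts_id.
Qed.

End Continuity.

(** Continuity is reduced along the outermost operation of the function; what is neither recognised
    nor assumed is left as a goal. *)
Ltac cts := repeat lazymatch goal with
  | |- forall y, continuous_at y (fun x => x) => exact: cts_id
  | |- forall y, continuous_at y (fun x => x.1) => exact: cts_fst
  | |- forall y, continuous_at y (fun x => x.2) => exact: cts_snd
  | |- forall y, continuous_at y fst => exact: cts_fst
  | |- forall y, continuous_at y snd => exact: cts_snd
  | |- forall y, continuous_at y (pair _) =>
      exact: cts_pair (@cts_cst _ _ _) (@cts_id _)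
  | |- forall y, continuous_at y (fun _ => ?c) => exact: cts_cst
  | |- forall y, continuous_at y (fun x => (@?f x, @?g x)) =>
      refine (@cts_pair _ _ _ f g _ _)
  | |- forall y, continuous_at y (fun x => @GRing.add _ (@?f x) (@?g x)) =>
      refine (@ctsD _ _ f g _ _)
  | |- forall y, continuous_at y (fun x => @GRing.opp _ (@?f x)) =>
      refine (@ctsN _ _ f _)
  | |- forall y, continuous_at y (fun x => @GRing.mul _ (@?f x) (@?g x)) =>
      refine (@ctsM _ _ f g _ _)
  | |- forall y, continuous_at y (fun x => Num.max (@?f x) (@?g x)) =>
      refine (@cts_max _ _ f g _ _)
  | |- forall y, continuous_at y (fun x => Num.min (@?f x) (@?g x)) =>
      refine (@cts_min _ _ f g _ _)
  | |- forall y, continuous_at y (fun x => fun_of_matrix (@?f x) _ ?j) =>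
      refine (@cts_coord _ _ _ f j _)
  | |- forall y, continuous_at y (fun x => clip (@?f x)) =>
      refine (@cts_comp _ _ _ f clip _ cts_clip)
  | |- forall y, continuous_at y (fun x => @Num.norm _ _ (@?f x)) =>
      refine (@cts_norm _ _ _ f _)
  | |- forall y, continuous_at y _ => eassumption
  end.

Section Loops.
Context {R : realType}.
Implicit Types (T : topologicalType) (n : nat).

Definition clipv n (t : 'rV[R]_n) : 'rV[R]_n := \row_i clip (t ord0 i).

Lemma cts_clipv n : continuous (@clipv n).
Proof.
by apply: cts_row => j; cts.
Qed.

Lemma cube_clipv n (t : 'rV[R]_n) : cube (clipv t).
Proof. by move=> i; rewrite mxE clip_itv. Qed.

Lemma clipv_id n (t : 'rV[R]_n) : cube t -> clipv t = t.
Proof. by move=> ct; apply/rowP => i; rewrite mxE clip_id. Qed.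

(** Points off the open unit cube.  Loops are extended to all of R^n by the
    base point there, so that every map below is globally continuous. *)
Definition out n (t : 'rV[R]_n) := exists i, t ord0 i <= 0 \/ 1 <= t ord0 i.

Lemma out_boundary n (t : 'rV[R]_n) : cube_boundary t -> out t.
Proof. by move=> [_ [i ti]]; exists i; case: ti => ->; [left|right]. Qed.

Lemma out_clipv n (t : 'rV[R]_n) : out t -> cube_boundary (clipv t).
Proof.
move=> [i ti]; split; [exact: cube_clipv|exists i; rewrite mxE].
by case: ti => ti; [left; rewrite clip_le0|right; rewrite clip_ge1].
Qed.

Lemma not_out n (t : 'rV[R]_n) : ~ out t -> cube t.
Proof.
move=> nt i; apply/andP; split; rewrite leNgt; apply/negP => h;
  apply: nt; exists i; [left|right]; exact: ltW.
Qed.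

Definition gloop T (y0 : T) n (F : 'rV[R]_n -> T) :=
  continuous F /\ forall t, out t -> F t = y0.

(** Global counterpart of [htp_rel]: parameter and space variable run over the whole line and all of
    R^n, so no continuity on subspaces is involved. *)
Definition ghtp T (S : set T) (y0 : T) n (F G : 'rV[R]_n -> T) :=
  exists H : R * 'rV[R]_n -> T, [/\ continuous H, forall p, S (H p),
    forall s t, out t -> H (s, t) = y0,
    forall t, H (0, t) = F t & forall t, H (1, t) = G t].

Lemma ghtp_refl T (y0 : T) n F : gloop y0 F -> @ghtp T setT y0 n F F.
Proof.
move=> [cF F0]; exists (fun p => F p.2); split => //.
by apply: (cts_comp _ cF); cts.
Qed.

Lemma ghtp_sym T S (y0 : T) n F G : @ghtp T S y0 n F G -> ghtp S y0 G F.
Proof.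
move=> [H [cH SH H0 HF HG]]; exists (fun p => H (1 - p.1, p.2)); split => //.
- by apply: (cts_comp _ cH); cts.
- by move=> s t /H0.
- by move=> t; rewrite subr0.
- by move=> t; rewrite subrr.
Qed.

Lemma ghtp_trans T S (y0 : T) n F G K :
  @ghtp T S y0 n F G -> ghtp S y0 G K -> ghtp S y0 F K.
Proof.
move=> [H [cH SH H0 HF HG]] [H' [cH' SH' H0' HG' HK']].
exists (fun p => if p.1 <= 2^-1 then H (clip (2 * p.1), p.2)
                 else H' (clip (2 * p.1 - 1), p.2)); split.
- apply: cts_paste; cts.
  + apply: (cts_comp _ cH); cts.
  + apply: (cts_comp _ cH'); cts.
  + move=> [s t] /= ->; rewrite divff// subrr (clip_le0 (lexx 0)) (clip_ge1 (lexx 1)).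
    by rewrite HG HG'.
- by move=> p; case: ifP.
- by move=> s t ot /=; case: ifP => _; rewrite (H0, H0').
- by move=> t /=; rewrite invr_ge0 ler0n mulr0 clip_le0.
- move=> t /=; case: ifPn => [|_]; last by rewrite mulr1 clip_ge1// lerBrDl.
  by rewrite invf_ge1// -[1]/(1%:R) ler_nat.
Qed.

Lemma gloop_ghtp T S (y0 : T) n F G : @ghtp T S y0 n F G -> gloop y0 F.
Proof.
move=> [H [cH _ H0 HF _]]; split.
  rewrite (_ : F = fun t => H (0, t)); last by apply/funext => t; rewrite HF.
  by apply: (cts_comp _ cH); cts.
by move=> t ot; rewrite -HF H0.
Qed.

Lemma Omega_gloop T (y0 : T) n (a : 'rV[R]_n -> T) :
  Omega y0 a -> gloop y0 (fun t => a (clipv t)).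
Proof.
move=> [ca a0]; split.
  by apply: within_cts_comp ca => //; [exact: cts_clipv|exact: cube_clipv].
by move=> t /out_clipv/a0.
Qed.

Lemma gloop_Omega T (y0 : T) n (F : 'rV[R]_n -> T) : gloop y0 F -> Omega y0 F.
Proof.
move=> [cF F0]; split; first exact: continuous_subspaceT.
by move=> t /out_boundary/F0.
Qed.

Lemma gloop_clipv T (y0 : T) n (F : 'rV[R]_n -> T) t :
  gloop y0 F -> F (clipv t) = F t.
Proof.
move=> [_ F0]; have [ot|/not_out ct] := pselect (out t).
  by rewrite !F0//; apply/out_boundary/out_clipv.
by rewrite clipv_id.
Qed.

(** Clipping both variables makes the homotopy global, and points of [out] are clipped to the
    boundary of the cube, where it rests at [y0]. *)
Lemma htp_rel_ghtp T S (y0 : T) n (f g : 'rV[R]_n -> T) :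
  htp_rel S y0 f g ->
  ghtp S y0 (fun t => f (clipv t)) (fun t => g (clipv t)).
Proof.
move=> [H [cH [SH [Hf [Hg H0]]]]].
exists (fun p => H (clip p.1, clipv p.2)); split.
- apply: (within_cts_comp _ _ cH).
    apply: cts_pair; cts; apply: (cts_comp _ (@cts_clipv n)); cts.
  by move=> p; split; [exact: clip_itv|exact: cube_clipv].
- by move=> p; apply: SH; [exact: clip_itv|exact: cube_clipv].
- by move=> s t /out_clipv ot; rewrite H0//; exact: clip_itv.
- by move=> t /=; rewrite clip_le0// Hf//; exact: cube_clipv.
- by move=> t /=; rewrite clip_ge1// Hg//; exact: cube_clipv.
Qed.

Lemma ghtp_htp_rel T S (y0 : T) n (F G f g : 'rV[R]_n -> T) :
  ghtp S y0 F G -> (forall t, cube t -> f t = F t) ->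
  (forall t, cube t -> g t = G t) -> htp_rel S y0 f g.
Proof.
move=> [H [cH SH H0 HF HG]] fF gG; exists H; split.
  exact: continuous_subspaceT.
split; first by move=> p _ _; exact: SH.
split; first by move=> t ct; rewrite HF fF.
split; first by move=> t ct; rewrite HG gG.
by move=> s t _ /out_boundary; exact: H0.
Qed.

End Loops.

(** * Homotopy classes of loops and the pseudometric *)

Section Pin.
Context {R : realType} {X : metricType R} {x0 : X} {n : nat}.
Implicit Types (a b : @pin R X x0 n) (F G : 'rV[R]_n -> X).

(** A representative and its clipped version agree on the cube, and the class only sees values
    there. *)
Lemma pin_gloop a al : sval a al ->
  gloop x0 (fun t => al (clipv t)) /\ sval a (fun t => al (clipv t)).
Proof.
case: a => A /= [a0 [Oa0 ->]] [Oal h].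
have gal := Omega_gloop Oal.
split=> //; split; first exact: gloop_Omega.
apply: (ghtp_htp_rel (htp_rel_ghtp h)); first by move=> t ct; rewrite clipv_id.
by [].
Qed.

Lemma pin_nonempty a : exists F, gloop x0 F /\ sval a F.
Proof.
case: a => A /= [a0 [Oa0 ->]].
have ga := Omega_gloop Oa0.
exists (fun t => a0 (clipv t)); split => //; split; first exact: gloop_Omega.
apply: (ghtp_htp_rel (ghtp_refl ga)) => // t ct; by rewrite clipv_id.
Qed.

Lemma pin_ghtp a F G : gloop x0 F -> sval a F -> ghtp setT x0 F G -> sval a G.
Proof.
move=> gF; case: a => A /= [a0 [Oa0 ->]] [OF h] FG.
split; first by apply: gloop_Omega; exact: gloop_ghtp (ghtp_sym FG).
have h2 : ghtp setT x0 (fun t => a0 (clipv t)) F.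
  have := htp_rel_ghtp h; congr (ghtp _ _ _ _).
  by apply/funext => t; exact: gloop_clipv gF.
apply: (ghtp_htp_rel (ghtp_trans h2 FG)) => // t ct; by rewrite clipv_id.
Qed.

Lemma mu_ge0 (al be : 'rV[R]_n -> X) : 0 <= mu al be.
Proof.
rewrite /mu; set S := [set _ | _ in _].
have S0 : S (mdist (al 0) (be 0)).
  by exists 0 => // i; rewrite mxE lexx ler01.
have [hS|hS] := pselect (has_sup S).
  by apply: le_trans (mdist_ge0 _ _) _; apply: ub_le_sup S0; case: hS.
(* Without a finite supremum, [sup] takes its default value 0. *)
by rewrite sup_out.
Qed.

Lemma rho_le a b F G e : sval a F -> sval b G -> 0 <= e ->
  (forall t, mdist (F t) (G t) <= e) -> rho a b <= e.
Proof.
move=> aF bG e0 FGe.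
apply: (@le_trans _ _ (mu F G)).
  apply: ge_inf; last by exists F, G.
  by exists 0 => _ [al [be [_ [_ ->]]]]; exact: mu_ge0.
apply: ge_sup.
  by exists (mdist (F 0) (G 0)), 0 => // i; rewrite mxE lexx ler01.
by move=> _ [t _ <-].
Qed.

End Pin.

(** * Concatenation and transitivity of closeness *)

Section Concatenation.
Context {R : realType} {T : topologicalType} {y0 : T} {n : nat} (i : 'I_n).
Implicit Types (F G : 'rV[R]_n -> T) (t : 'rV[R]_n).

Definition upd t (x : R) : 'rV[R]_n := \row_j (if j == i then x else t ord0 j).

Lemma cts_upd (U : topologicalType) (f : U -> 'rV[R]_n) (g : U -> R) :
  continuous f -> continuous g -> continuous (fun p => upd (f p) (g p)).
Proof.
move=> cf cg; apply: cts_row => j.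
case: (j == i); [exact: cg|exact: cts_coord].
Qed.

Lemma out_upd t x : x <= 0 \/ 1 <= x -> out (upd t x).
Proof. by move=> hx; exists i; rewrite mxE eqxx. Qed.

Lemma upd_out t x : out t ->
  (t ord0 i <= 0 \/ 1 <= t ord0 i -> x <= 0 \/ 1 <= x) -> out (upd t x).
Proof.
move=> [j tj] hx; have [ji|ji] := eqVneq j i.
  by apply: out_upd; apply: hx; rewrite -ji.
by exists j; rewrite mxE (negbTE ji).
Qed.

Lemma upd_id t : upd t (t ord0 i) = t.
Proof. by apply/rowP => j; rewrite mxE; case: eqP => // ->. Qed.

Lemma clip01 (s : R) : 0 <= clip s /\ clip s <= 1.
Proof. by have /andP[] := clip_itv s. Qed.

(** The hypotheses make [x |-> a * x - b] at most 0 for [x <= 0] and at least 1 for [x >= 1]. This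
    persists along the affine deformation of this map to the identity, and so does the loop
    condition. *)
Lemma reparam_ghtp F (a b : R) : gloop y0 F -> 1 <= a -> 0 <= b -> b <= a - 1 ->
  ghtp setT y0 (fun t => F (upd t (a * t ord0 i - b))) F.
Proof.
move=> [cF F0] a1 b0 ba.
exists (fun p : R * 'rV[R]_n => F (upd p.2 ((a - (a - 1) * clip p.1) * p.2 ord0 i
                             - b * (1 - clip p.1)))); split => //.
- apply: (cts_comp _ cF); apply: cts_upd; cts.
- move=> s t ot; apply: F0; apply: upd_out => //= ti.
  have [s0 s1] := clip01 s.
  have h1 : 0 <= b * (1 - clip s) by apply: mulr_ge0; lra.
  have h2 : 0 <= (a - 1 - b) * (1 - clip s) by apply: mulr_ge0; lra.
  have h3 : 0 <= (a - 1) * (1 - clip s) by apply: mulr_ge0; lra.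
  case: ti => ti; [left|right]; nra.
- by move=> t /=; rewrite clip_le0// mulr0 subr0 subr0 mulr1.
- move=> t /=; rewrite clip_ge1// mulr1 opprB addrCA subrr addr0 mul1r.
  by rewrite subrr mulr0 subr0 upd_id.
Qed.

(** The concatenation F1 * F2^-1 * F3 along the [i]-th coordinate. *)
Definition tri (F1 F2 F3 : R * 'rV[R]_n -> T) (p : R * 'rV[R]_n) : T :=
  let x := 3 * p.2 ord0 i in
  if x <= 1 then F1 (p.1, upd p.2 x)
  else if x <= 2 then F2 (p.1, upd p.2 (2 - x))
  else F3 (p.1, upd p.2 (x - 2)).

Lemma tri_fam (F1 F2 F3 : R * 'rV[R]_n -> T) :
  (continuous F1 /\ forall s t, out t -> F1 (s, t) = y0) ->
  (continuous F2 /\ forall s t, out t -> F2 (s, t) = y0) ->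
  (continuous F3 /\ forall s t, out t -> F3 (s, t) = y0) ->
  continuous (tri F1 F2 F3) /\ forall s t, out t -> tri F1 F2 F3 (s, t) = y0.
Proof.
move=> [c1 F10] [c2 F20] [c3 F30]; split; last first.
  move=> s t ot; rewrite /tri/=; case: ifPn => [h|h].
    by rewrite F10//; apply: upd_out => // -[]; [left|right]; lra.
  case: ifPn => h'.
    by rewrite F20//; apply: upd_out => // -[]; [right|left]; lra.
  by rewrite F30//; apply: upd_out => // -[]; [left|right]; lra.
rewrite /tri; apply: cts_paste; cts.
- by apply: (cts_comp _ c1); cts; apply: cts_upd; cts.
- apply: cts_paste; cts.
  + by apply: (cts_comp _ c2); cts; apply: cts_upd; cts.
  + by apply: (cts_comp _ c3); cts; apply: cts_upd; cts.
  + move=> x ->; rewrite subrr F20 ?F30//; apply: out_upd; left; exact: lexx.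
- move=> x /= x1; rewrite ifT ?x1 ?ler1n//.
  by rewrite F10 ?F20//; apply: out_upd; right; lra.
Qed.

Definition triL F1 F2 F3 t :=
  tri (fun p => F1 p.2) (fun p => F2 p.2) (fun p => F3 p.2) (0, t).

Lemma tri_ghtp F1 F2 F3 G1 G2 G3 : ghtp setT y0 F1 G1 -> ghtp setT y0 F2 G2 ->
  ghtp setT y0 F3 G3 -> ghtp setT y0 (triL F1 F2 F3) (triL G1 G2 G3).
Proof.
move=> [H1 [c1 _ o1 a1 b1]] [H2 [c2 _ o2 a2 b2]] [H3 [c3 _ o3 a3 b3]].
have [cH oH] := tri_fam (conj c1 o1) (conj c2 o2) (conj c3 o3).
exists (tri H1 H2 H3); split => // t; rewrite /triL /tri /=.
  by rewrite a1 a2 a3.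
by rewrite b1 b2 b3.
Qed.

(** The part [G^-1 G] is [G] run along [|3x - 2|]. Deforming this path to the constant 1, where [G]
    rests at [y0], leaves [F] on the first third, and [reparam_ghtp] stretches it. *)
Lemma tri_cancelr F G : gloop y0 F -> gloop y0 G ->
  ghtp setT y0 (triL F G G) F.
Proof.
move=> gF gG; apply: (ghtp_trans (G := fun t => F (upd t (3 * t ord0 i - 0))));
  last by apply: reparam_ghtp => //; lra.
case: gF gG => cF F0 [cG G0].
exists (fun p : R * 'rV[R]_n => if 3 * p.2 ord0 i <= 1 then F (upd p.2 (3 * p.2 ord0 i))
  else G (upd p.2 ((1 - clip p.1) * `|3 * p.2 ord0 i - 2| + clip p.1))); split.
- apply: cts_paste; cts.
  + by apply: (cts_comp _ cF); cts; apply: cts_upd; cts.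
  + apply: (cts_comp _ cG); cts; apply: cts_upd; cts.
  + move=> p ->; rewrite (_ : `|_| = 1).
      by rewrite mulr1 subrK F0 ?G0//; apply: out_upd; right.
    by rewrite ler0_norm; lra.
- by [].
- move=> s t ot /=; have [s0 s1] := clip01 s; case: ifPn => [h|h].
    by rewrite F0//; apply: upd_out => // -[]; [left|right]; lra.
  rewrite G0//; apply: upd_out => // -[h'|h']; first by lra.
  by right; rewrite ger0_norm; nra.
- move=> t /=; rewrite /triL /tri /= clip_le0// subr0 mul1r addr0.
  case: ifPn => // h; case: ifPn => h'.
    by rewrite ler0_norm ?opprB//; lra.
  by rewrite ger0_norm//; lra.
- move=> t /=; rewrite clip_ge1// subrr mul0r add0r subr0.
  case: ifPn => // h; rewrite G0 ?F0//; apply: out_upd; right => //; lra.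
Qed.

(** Mirror image of [tri_cancelr]: [G G^-1] is [G] run along [1 - |3x - 1|], which is deformed to
    the constant 0. *)
Lemma tri_cancell F G : gloop y0 F -> gloop y0 G ->
  ghtp setT y0 (triL G G F) F.
Proof.
move=> gF gG; apply: (ghtp_trans (G := fun t => F (upd t (3 * t ord0 i - 2))));
  last by apply: reparam_ghtp => //; lra.
case: gF gG => cF F0 [cG G0].
exists (fun p : R * 'rV[R]_n => if 3 * p.2 ord0 i <= 2
  then G (upd p.2 ((1 - clip p.1) * (1 - `|3 * p.2 ord0 i - 1|)))
  else F (upd p.2 (3 * p.2 ord0 i - 2))); split.
- apply: cts_paste; cts.
  + apply: (cts_comp _ cG); cts; apply: cts_upd; cts.
  + by apply: (cts_comp _ cF); cts; apply: cts_upd; cts.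
  + move=> p ->; rewrite (_ : `|_| = 1).
      by rewrite !subrr mulr0 F0 ?G0//; apply: out_upd; left.
    by rewrite ger0_norm; lra.
- by [].
- move=> s t ot /=; have [s0 s1] := clip01 s; case: ifPn => [h|h].
    rewrite G0//; apply: upd_out => // -[h'|h']; last by lra.
    by left; rewrite ler0_norm; nra.
  by rewrite F0//; apply: upd_out => // -[]; [left|right]; lra.
- move=> t /=; rewrite /triL /tri /= clip_le0// subr0 mul1r.
  have [h|h] := leP (3 * t ord0 i) 1.
    rewrite ifT; last by lra.
    by rewrite ler0_norm; [congr G; congr upd => /=; lra|lra].
  case: ifPn => h' //.
  by rewrite ger0_norm; [congr G; congr upd => /=; lra|lra].
- move=> t /=; rewrite clip_ge1// subrr mul0r.
  case: ifPn => // h; rewrite G0 ?F0//; apply: out_upd; left => //; lra.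
Qed.

End Concatenation.

Section Close.
Context {R : realType} {X : metricType R} {x0 : X} {n : nat}.
Implicit Types (F G K : 'rV[R]_n -> X) (e : R).

Definition close e F G := exists F' G', [/\ ghtp setT x0 F F',
  ghtp setT x0 G G' & forall t, mdist (F' t) (G' t) < e].

Lemma close_pt e F G : gloop x0 F -> gloop x0 G ->
  (forall t, mdist (F t) (G t) < e) -> close e F G.
Proof. by move=> gF gG FG; exists F, G; split => //; exact: ghtp_refl. Qed.

(** If F', G' are close and G'', K' are close with G' ~ G ~ G'', then
    F' G'^-1 G'' ~ F' and G' G'^-1 K' ~ K' are close. *)
Lemma close_trans e F G K : (0 < n)%N -> close e F G -> close e G K -> close e F K.
Proof.
move=> n0 [F' [G' [FF' GG' FG]]] [G'' [K' [GG'' KK' GK]]].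
pose i := Ordinal n0.
have gF' := gloop_ghtp (ghtp_sym FF').
have gG' := gloop_ghtp (ghtp_sym GG').
have gG'' := gloop_ghtp (ghtp_sym GG'').
have gK' := gloop_ghtp (ghtp_sym KK').
have e0 : 0 < e := le_lt_trans (mdist_ge0 _ _) (FG 0).
exists (triL i F' G' G''), (triL i G' G' K'); split.
- apply: (ghtp_trans FF'); apply: ghtp_sym.
  apply: (ghtp_trans _ (tri_cancelr i gF' gG')).
  apply: tri_ghtp; try exact: ghtp_refl.
  exact: ghtp_trans (ghtp_sym GG'') GG'.
- by apply: (ghtp_trans KK'); apply: ghtp_sym; exact: tri_cancell.
- move=> t; rewrite /triL /tri /=; case: ifPn => // _; case: ifPn => // _.
  by rewrite mdistxx.
Qed.

Lemma close_sym e F G : close e F G -> close e G F.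
Proof.
by move=> [F' [G' [FF' GG' FG]]]; exists G', F'; split => // t; rewrite metric_sym.
Qed.

Lemma close_ghtp e F G F' G' : ghtp setT x0 F F' -> ghtp setT x0 G G' ->
  close e F' G' -> close e F G.
Proof.
move=> FF' GG' [F'' [G'' [FF'' GG'' FG]]]; exists F'', G''; split => //.
  exact: ghtp_trans FF''.
exact: ghtp_trans GG''.
Qed.

Lemma close_rho (a b : @pin R X x0 n) F G e : sval a F -> sval b G ->
  gloop x0 F -> gloop x0 G -> close e F G -> rho a b <= e.
Proof.
move=> aF bG gF gG [F' [G' [FF' GG' FG]]].
have e0 : 0 < e := le_lt_trans (mdist_ge0 _ _) (FG 0).
apply: (rho_le (pin_ghtp gF aF FF') (pin_ghtp gG bG GG')); first exact: ltW.
by move=> t; apply: ltW.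
Qed.

End Close.

(** * Change of base point *)

Section Transport.
Context {R : realType} {T : topologicalType} {n : nat}.
Implicit Types (F G : 'rV[R]_n -> T) (t : 'rV[R]_n).

Lemma coord_le_norm m (v : 'rV[R]_m) i : `|v ord0 i| <= `|v|.
Proof.
by rewrite [leRHS]/Num.norm/= mx_normrE; apply/bigmax_geP; right => /=; exists (ord0, i).
Qed.

Lemma norm_coord m (v : 'rV[R]_m) : 0 < `|v| -> exists i, `|v| = `|v ord0 i|.
Proof.
move=> v0; have [] := @mx_norm_neq0 _ _ _ v; first by rewrite -[mx_norm v]/`|v| gt_eqF.
by move=> [a j] /= vj; exists j; rewrite [LHS]vj (ord1 a).
Qed.

(** The sup norm about the centre of the cube, scaled so that the cube is the unit ball. *)
Definition radius t : R := `|2 *: t - const_mx 1|.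

(** The homothety of ratio [a] about the centre of the cube. *)
Definition dil (a : R) t : 'rV[R]_n := \row_j (a * (t ord0 j - 2^-1) + 2^-1).

Lemma radius_dil a t : 0 <= a -> radius (dil a t) = a * radius t.
Proof.
move=> a0; rewrite /radius -[in RHS](ger0_norm a0) -normrZ; congr (`|_|).
by apply/rowP => j; rewrite !mxE; field.
Qed.

Lemma out_radius t : out t <-> 1 <= radius t.
Proof.
split=> [[i ti]|r1].
  apply: le_trans (coord_le_norm _ i); rewrite !mxE.
  by case: ti => ti; [rewrite ler0_norm|rewrite ger0_norm]; lra.
have [|i ri] := @norm_coord _ (2 *: t - const_mx 1); first exact: lt_le_trans r1.
move: r1; rewrite /radius ri !mxE => r1; exists i.
have [|] := leP 0 (2 * t ord0 i - 1) => h.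
  by right; move: r1; rewrite ger0_norm//; lra.
by left; move: r1; rewrite ltr0_norm//; lra.
Qed.

Lemma cts_dil (U : topologicalType) (a : U -> R) (f : U -> 'rV[R]_n) :
  continuous a -> continuous f -> continuous (fun x => dil (a x) (f x)).
Proof. by move=> ca cf; apply: cts_row => j; cts. Qed.

Lemma cts_radius (U : topologicalType) (f : U -> 'rV[R]_n) :
  continuous f -> continuous (fun x => radius (f x)).
Proof.
move=> cf; apply: (@cts_norm _ _ 'rV[R]_n).
have -> : (fun x => 2 *: f x - const_mx 1) =
          (fun x => \row_j (2 * f x ord0 j - 1)).
  by apply/funext => x; apply/rowP => j; rewrite !mxE.
by apply: cts_row => j; cts.
Qed.

(** The concentric cube of half size carries [H]. On the collar around it the depth [2 - 2 * radius]
    falls from 1 at the inner face to 0 at the outer one. *)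
Definition star (D : R * R -> T) (H : R * 'rV[R]_n -> T) (p : R * 'rV[R]_n) :=
  if radius p.2 <= 2^-1 then H (p.1, dil 2 p.2)
  else D (p.1, 2 - 2 * radius p.2).

Lemma star_cts (D : R * R -> T) (H : R * 'rV[R]_n -> T) :
  continuous D -> continuous H ->
  (forall s t, out t -> H (s, t) = D (s, 1)) -> continuous (star D H).
Proof.
move=> cD cH HD; apply: cts_paste; cts; rewrite ?/comp.
- by apply: cts_radius; cts.
- by apply: (cts_comp _ cH); cts; apply: cts_dil; cts.
- by apply: (cts_comp _ cD); cts; apply: cts_radius; cts.
- move=> [s t] /= rt; rewrite HD ?rt.
    by congr (D (_, _)); lra.
  by apply/out_radius; rewrite radius_dil ?rt; lra.
Qed.

Lemma star_out (D : R * R -> T) (H : R * 'rV[R]_n -> T) s t b :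
  (forall x, x <= 0 -> D (s, x) = b) -> out t ->
  star D H (s, t) = b.
Proof.
move=> Db /out_radius r1; rewrite /star /= ifF ?Db//; first by lra.
by apply/negbTE; rewrite -ltNge; lra.
Qed.

(** Transport of a loop at [d 1] along the path [d] to a loop at [d 0]:
    the loop is shrunk to a concentric cube and [d] fills the collar. *)
Definition transport (d : R -> T) F t :=
  star (fun q => d (clip q.2)) (fun p => F p.2) (0, t).

Lemma transport_ghtp S (d : R -> T) F G : continuous d -> (forall x, S (d x)) ->
  ghtp S (d 1) F G -> ghtp S (d 0) (transport d F) (transport d G).
Proof.
move=> cd Sd [H [cH SH oH HF HG]].
exists (star (fun q => d (clip q.2)) H); split.
- apply: star_cts => //; first by apply: (cts_comp _ cd); cts.
  by move=> s t /oH -> /=; rewrite clip_ge1.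
- by move=> p; rewrite /star; case: ifP.
- by move=> s t ot; apply: star_out => // x x0 /=; rewrite clip_le0.
- by move=> t; rewrite /transport /star /= HF.
- by move=> t; rewrite /transport /star /= HG.
Qed.

Lemma transport_gloop (d : R -> T) F : continuous d -> gloop (d 1) F ->
  gloop (d 0) (transport d F).
Proof.
move=> cd gF; apply: (@gloop_ghtp _ _ setT _ _ _ (transport d F)).
by apply: transport_ghtp => //; exact: ghtp_refl.
Qed.

(** While the ratio is interpolated from [a] to 1 it never drops below 1, so points of [out] stay in
    [out]. *)
Lemma dil_ghtp (y0 : T) F a : gloop y0 F -> 1 <= a ->
  ghtp setT y0 (fun t => F (dil a t)) F.
Proof.
move=> [cF F0] a1.
exists (fun p => F (dil (a - (a - 1) * clip p.1) p.2)); split => //.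
- by apply: (cts_comp _ cF); apply: cts_dil; cts.
- move=> s t /out_radius r1; apply: F0; apply/out_radius.
  have [s0 s1] := clip01 s.
  have h : 0 <= (a - 1) * (1 - clip s) by apply: mulr_ge0; lra.
  by rewrite radius_dil; nra.
- by move=> t /=; rewrite clip_le0// mulr0 subr0.
- move=> t /=; rewrite clip_ge1// mulr1 opprB addrCA subrr addr0.
  by congr F; apply/rowP => j; rewrite !mxE; lra.
Qed.

Lemma transport_cancel (d : R -> T) F : continuous d -> gloop (d 1) F ->
  ghtp setT (d 1) (transport (fun x => d (1 - x)) (transport d F)) F.
Proof.
move=> cd gF.
apply: (@ghtp_trans _ _ _ _ _ _ (fun t => F (dil 4 t))); last first.
  by apply: dil_ghtp => //; rewrite ler1n.
case: gF => cF F0.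
(* At time [s] the inner collar follows [d] only from 1 down to [s], and the outer one returns from
   [s] to 1. At [s = 1] both are constant, and the two halvings leave the loop dilated by 4. *)
pose D1 (q : R * R) := d ((1 - clip q.1) * clip q.2 + clip q.1).
pose D2 (q : R * R) := d ((1 - clip q.1) * (1 - clip q.2) + clip q.1).
have c1 : continuous D1 by apply: (cts_comp _ cd); cts.
have c2 : continuous D2 by apply: (cts_comp _ cd); cts.
have cS : continuous (star D1 (fun p => F p.2)).
  apply: star_cts => //; first by apply: (cts_comp _ cF); cts.
  by move=> s t /F0 /= ->; rewrite /D1 /= (clip_ge1 (lexx 1)) mulr1 subrK.
exists (star D2 (star D1 (fun p => F p.2))); split => //.
- apply: star_cts => // s t ot.
  rewrite (@star_out _ _ _ _ (d (clip s)) _ ot).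
    by rewrite /D2 /= (clip_ge1 (lexx 1)) subrr mulr0 add0r.
  by move=> x x0; rewrite /D1 /= (clip_le0 x0) mulr0 add0r.
- move=> s t ot; apply: star_out => // x x0.
  by rewrite /D2 /= (clip_le0 x0) subr0 mulr1 subrK.
- move=> t; rewrite /transport /star /D1 /D2 /= (clip_le0 (lexx 0)).
  by rewrite !subr0 !mul1r !addr0.
- move=> t; rewrite /star /D1 /D2 /= (clip_ge1 (lexx 1)) !subrr !mul0r !add0r.
  have Ft : 4^-1 < radius t -> F (dil 4 t) = d 1.
    by move=> rt; apply/F0/out_radius; rewrite radius_dil//; lra.
  case: ifPn => [rt|]; last by rewrite -ltNge => rt; rewrite Ft//; lra.
  rewrite radius_dil//; case: ifPn => [rt'|].
    by congr F; apply/rowP => j; rewrite !mxE; field.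
  by rewrite -ltNge => rt'; rewrite Ft//; lra.
Qed.

End Transport.

Lemma transport_comp {R : realType} {T U : topologicalType} n (k : T -> U)
    (d : R -> T) (F : 'rV[R]_n -> T) t :
  k (transport d F t) = transport (fun x => k (d x)) (fun t => k (F t)) t.
Proof. by rewrite /transport /star /=; case: ifP. Qed.

Lemma transport_dist {R : realType} {X : metricType R} n e (d : R -> X)
    (F G : 'rV[R]_n -> X) :
  0 < e -> (forall t, mdist (F t) (G t) < e) ->
  forall t, mdist (transport d F t) (transport d G t) < e.
Proof.
by move=> e0 FG t; rewrite /transport /star /=; case: ifP; rewrite ?mdistxx.
Qed.

(** * The topology of [rho] is finer *)

Section Uniformity.
Context {R : realType}.

(** Compactness in its near-covering form, applied to the filter of positive [d] tending to 0. This
    is the source of the Lebesgue numbers and moduli of continuity below. *)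
Lemma compact_uniform (T : topologicalType) (K : set T) (P : R -> T -> Prop) :
  compact K ->
  (forall x, K x -> exists2 e, 0 < e &
     \forall y \near x, forall d, 0 < d < e -> P d y) ->
  exists2 d, 0 < d & forall x, K x -> P d x.
Proof.
move=> /compact_near_coveringP cK hP.
have := cK R (0^'+) (fun d x => P d x) _.
case.
  move=> x Kx; have [e e0 he] := hP x Kx.
  exists ([set y | forall d, 0 < d < e -> P d y], [set d | 0 < d < e]) => /=.
    by split => //; near=> d; apply/andP; split; near: d;
       [exact: nbhs_right_gt|exact: nbhs_right_lt].
  by move=> [y d] /= [h /h].
move=> d /= d0 hd.
exists (d / 2); first by rewrite divr_gt0.
move=> x Kx; apply: (hd (d / 2)) => //=; rewrite ?divr_gt0//.
by rewrite sub0r normrN gtr0_norm ?divr_gt0// ltr_pdivrMr// ltr_pMr// ltr1n.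
Unshelve. all: by end_near. Qed.

Lemma mdist_near (X : metricType R) (x : X) e :
  0 < e -> \forall y \near x, mdist x y < e.
Proof.
by move=> e0; have := nbhsx_ballx x e e0; rewrite ballEmdist.
Qed.

Lemma nbhs_mdist (X : metricType R) (x : X) (A : set X) : nbhs x A ->
  exists2 e, 0 < e & forall y, mdist x y < e -> A y.
Proof.
move=> /nbhs_ballP [e /= e0 eA]; exists e => // y xy; apply: eA.
by rewrite ballEmdist.
Qed.

Lemma mdist_cts (T : topologicalType) (X : metricType R) (f g : T -> X) :
  continuous f -> continuous g -> continuous (fun x => mdist (f x) (g x)).
Proof.
move=> cf cg x; apply/cvgrPdist_lt => e e0.
have e2 : 0 < e / 2 by rewrite divr_gt0.
have nf := cf x _ (mdist_near (f x) e2).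
have ng := cg x _ (mdist_near (g x) e2).
have nfg : nbhs x [set y | mdist (f x) (f y) < e / 2 /\
    mdist (g x) (g y) < e / 2] by apply: filterI.
apply: (@filterS _ (nbhs x)) nfg => y [fy gy].
have h1 := metric_triangle (f x) (f y) (g x).
have h2 := metric_triangle (f y) (g y) (g x).
have h3 := metric_triangle (f y) (f x) (g y).
have h4 := metric_triangle (f x) (g x) (g y).
rewrite (metric_sym (g y) (g x)) in h2; rewrite (metric_sym (f y) (f x)) in h3.
by rewrite ltr_norml; apply/andP; split; lra.
Qed.

Lemma compact_bounded (X : metricType R) (x0 : X) : compact [set: X] ->
  exists D : R, forall x : X, mdist x0 x <= D.
Proof.
(* [compact_uniform] produces small constants, so the bound is sought as an inverse. *)
move=> cX; have [|d d0 hd] := @compact_uniform X setT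
    (fun d y => mdist x0 y <= d^-1) cX; last by exists d^-1 => x; exact: hd.
move=> x _; have D0 := mdist_ge0 x0 x.
have D1 : 0 < mdist x0 x + 1 by lra.
exists (mdist x0 x + 1)^-1; first by rewrite invr_gt0.
apply: (@filterS _ (nbhs x)) (mdist_near x ltr01) => y xy d /andP[d0 de].
have := metric_triangle x0 x y.
have : mdist x0 x + 1 < d^-1 by rewrite -[ltLHS]invrK ltf_pV2 ?posrE ?invr_gt0.
lra.
Qed.

(** Around a point of the closed support of [phi i] a ball lies in [U i]; near any other point
    [phi i] is not positive. The minimum of the radii serves all [i], and compactness makes it
    uniform in the point. *)
Lemma pou_lebesgue (X : metricType R) (x0 : X) m (U : 'I_m -> set X) i0 phi :
  compact [set: X] -> (forall i, open (U i)) ->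
  @pou_subordinate R X x0 m U i0 phi ->
  exists2 e : R, 0 < e & forall x y i, mdist x y < e -> 0 < phi i y -> U i x.
Proof.
move=> cX oU [cphi [_ [_ [clU _]]]].
have [|d d0 hd] := @compact_uniform X setT
  (fun d y => forall i x, mdist x y < d -> 0 < phi i y -> U i x) cX; last first.
  by exists d => // x y i; apply: hd.
move=> y _.
have hi i : exists2 e : R, 0 < e & \forall z \near y, forall x, mdist x z < e ->
    0 < phi i z -> U i x.
  have [cy|cy] := pselect (closure [set x | 0 < phi i x] y).
    have [e e0 he] := nbhs_mdist (open_nbhs_nbhs (conj (oU i) (clU i _ cy))).
    exists (e / 2); first by rewrite divr_gt0.
    have e20 : 0 < e / 2 by rewrite divr_gt0.
    apply: (@filterS _ (nbhs y)) (mdist_near y e20) => z yz x xz _.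
    apply: he; have := metric_triangle y z x; rewrite (metric_sym z x); lra.
  exists 1 => //.
  have : nbhs y (~` closure [set x | 0 < phi i x]).
    by apply: open_nbhs_nbhs; split => //; apply: closed_openC; exact: closed_closure.
  apply: (@filterS _ (nbhs y)) => z cz x _ pz; exfalso; apply: cz.
  exact: subset_closure.
have [e he] := choice (fun i => let: ex_intro2 e p q := hi i in
  ex_intro (fun e : R => 0 < e /\ \forall z \near y, forall x, mdist x z < e ->
    0 < phi i z -> U i x) e (conj p q)).
pose E := \big[Num.min/1]_i e i.
exists E.
  rewrite /E; elim/big_ind: _ => // [a b a0 b0|i _]; first by rewrite lt_min a0.
  by case: (he i).
have : \forall z \near y, forall i, forall x, mdist x z < e i ->
    0 < phi i z -> U i x by apply: filter_forall => i; case: (he i).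
apply: (@filterS _ (nbhs y)) => z hz d /andP[_ dE] i x xz; apply: hz.
by apply: (lt_trans xz); apply: (lt_le_trans dE); apply: bigmin_le_cond.
Qed.

End Uniformity.

Lemma support_neq0 {R : realType} m (t : 'rV[R]_m) :
  (forall i, 0 <= t ord0 i) -> \sum_i t ord0 i = 1 ->
  finset (fun i : 'I_m => 0 < t ord0 i) != finset.set0.
Proof.
move=> t0 t1; apply/negP => /eqP h; have := t1; rewrite big1 => [/eqP|i _].
  by rewrite eq_sym oner_eq0.
have : i \notin finset (fun j : 'I_m => 0 < t ord0 j) by rewrite h finset.in_set0.
by rewrite inE -leNgt => ti; apply/eqP; rewrite eq_le ti t0.
Qed.

Section Canonical.
Context {R : realType} (X : metricType R) (x0 : X) m (U : 'I_m -> set X)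
  (i0 : 'I_m) (phi : 'I_m -> X -> R).
Hypothesis pouU : pou_subordinate x0 U i0 phi.

Lemma pou_support i x : 0 < phi i x -> U i x.
Proof.
by have [_ [_ [_ [clU _]]]] := pouU => px; apply: clU; exact: subset_closure.
Qed.

Lemma canonical_map_cts : continuous (canonical_map phi).
Proof. by have [cphi _] := pouU; apply: cts_row. Qed.

Lemma canonical_map_base : canonical_map phi x0 = vertex i0.
Proof.
have [_ [phi0 [phi1 [_ phix0]]]] := pouU.
apply/rowP => i; rewrite !mxE; have [->//|ii0] := eqVneq i i0.
apply/eqP; rewrite eq_le phi0 andbT -(lerD2l (phi i0 x0)) addr0 [leRHS]phix0.
rewrite -(phi1 x0) (bigD1 i0)//= lerD2l (bigD1 i)//= lerDl.
by apply: sumr_ge0.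
Qed.

Lemma canonical_map_realization x : realization (nerve U) (canonical_map phi x).
Proof.
have [_ [phi0 [phi1 _]]] := pouU.
have p0 i : 0 <= canonical_map phi x ord0 i by rewrite mxE.
have p1 : \sum_i canonical_map phi x ord0 i = 1.
  by under eq_bigr do rewrite mxE.
split => //; split => //; split; first exact: support_neq0.
by exists x => i; rewrite inE mxE; exact: pou_support.
Qed.

End Canonical.

Section ShapeRho.
Context {R : realType} (X : metricType R) (x0 : X) (n : nat).

Lemma shape_open_rho_open (A : set (@pin R X x0 n)) :
  compact [set: X] -> shape_open A -> rho_open A.
Proof.
move=> cX sA a Aa; have [m [U [i0 [phi [covU [pouU hA]]]]]] := sA a Aa.
have [oU _] := covU.
have [e e0 he] := pou_lebesgue cX oU pouU.
have [D hD] := compact_bounded x0 cX.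
exists e => // b ab; apply: hA.
have [F [_ aF]] := pin_nonempty a.
have [G [_ bG]] := pin_nonempty b.
have hinf : has_inf [set r : R | exists al be, sval a al /\ sval b be /\ r = mu al be].
  split; first by exists (mu F G), F, G.
  by exists 0 => _ [al [be [_ [_ ->]]]]; exact: mu_ge0.
(* The infimum is approached by representatives whose distance is still below [e]. *)
have er0 : 0 < e - rho a b by rewrite subr_gt0.
have [_ [al [be [aal [bbe ->]]]]] := inf_adherent er0 hinf.
rewrite addrC subrK => mue.
have close t : cube t -> mdist (al t) (be t) < e.
  move=> ct; apply: le_lt_trans mue; apply: ub_le_sup; last by exists t.
  (* Boundedness of [X] makes the supremum a true upper bound of the distances. *)
  exists (D + D) => _ [u _ <-].
  have := metric_triangle (al u) x0 (be u); rewrite (metric_sym (al u) x0).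
  by have := hD (al u); have := hD (be u); lra.
have [cal al0] := (pin_gloop aal).1.
have [cbe be0] := (pin_gloop bbe).1.
have [cphi [phi0 [phi1 _]]] := pouU.
have phi_x0 i : phi i x0 = (i == i0)%:R.
  by have /rowP/(_ i) := canonical_map_base pouU; rewrite !mxE.
exists al, be; split => //; split => //.
exists (fun p => \row_i ((1 - clip p.1) * phi i (al (clipv p.2))
                         + clip p.1 * phi i (be (clipv p.2)))).
split.
  apply: continuous_subspaceT; apply: cts_row => i; cts.
  - by apply: (cts_comp _ (cphi i)); apply: (cts_comp _ cal); cts.
  - by apply: (cts_comp _ (cphi i)); apply: (cts_comp _ cbe); cts.
split.
  move=> [s t] /= s01 ct; rewrite clip_id// clipv_id//.
  move/andP: s01 => [s0 s1].
  set h := \row_i _.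
  have h0 i : 0 <= h ord0 i.
    by rewrite mxE; apply: addr_ge0; apply: mulr_ge0 => //; lra.
  have h1 : \sum_i h ord0 i = 1.
    under eq_bigr do rewrite mxE.
    by rewrite big_split/= -!mulr_sumr !phi1 !mulr1 subrK.
  split => //; split => //; split; first exact: support_neq0.
  (* [al t] is a common point of the members in the support: if [phi i] is positive at [be t], the
     choice of [e] puts [al t] in [U i]; otherwise [phi i] is positive at [al t] itself. *)
  exists (al t) => i; rewrite inE mxE => hi.
  have [p0|p0] := leP (phi i (be t)) 0; last exact: he (close _ ct) p0.
  apply: (he (al t) (al t)); first by rewrite mdistxx.
  rewrite lt_neqAle phi0 andbT eq_sym; apply/negP => /eqP pa.
  by move: hi; rewrite pa mulr0 add0r ltNge mulr_ge0_le0.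
split.
  move=> t ct; apply/rowP => i; rewrite !mxE /= clipv_id// clip_le0//.
  by rewrite subr0 mul0r mul1r addr0.
split.
  move=> t ct; apply/rowP => i; rewrite !mxE /= clipv_id// clip_ge1//.
  by rewrite subrr mul0r mul1r add0r.
move=> s t _ /out_boundary ot; apply/rowP => i; rewrite !mxE /= al0// be0//.
by rewrite phi_x0 -mulrDl subrK mul1r.
Qed.

End ShapeRho.

(** * Fine covers *)

Section SmallCover.
Context {R : realType} (X : metricType R) (x0 : X).

(** [pointed_cover] asks for an injectively indexed cover: equal members are
    merged by adding up their partition functions. *)
Lemma pou_injective m (V : 'I_m -> set X) i0 (phi : 'I_m -> X -> R) :
  (forall i, open (V i)) -> (forall x, exists i, V i x) -> V i0 x0 ->
  pou_subordinate x0 V i0 phi ->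
  exists k (U : 'I_k -> set X) j0 (psi : 'I_k -> X -> R),
    [/\ pointed_cover x0 U j0, pou_subordinate x0 U j0 psi &
        forall j, exists i, U j = V i].
Proof.
move=> oV covV Vx0 [cphi [phi0 [phi1 [clV phix0]]]].
pose s := undup [seq V i | i <- enum 'I_m].
pose U (j : 'I_(size s)) := nth (set0 : set X) s j.
have UV j : exists i, U j = V i.
  have : U j \in s by exact: mem_nth.
  by rewrite mem_undup => /mapP [i _ ->]; exists i.
have VU i : exists j, V i = U j.
  have Vs : V i \in s by rewrite mem_undup; apply: map_f; rewrite mem_enum.
  have si : (index (V i) s < size s)%N by rewrite index_mem.
  by exists (Ordinal si); rewrite /U /= nth_index.
have injU : injective U.
  move=> j j' /eqP; rewrite /U nth_uniq ?undup_uniq ?ltn_ord// => /eqP.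
  exact: val_inj.
pose psi (j : 'I_(size s)) x := \sum_(i | V i == U j) phi i x.
have psi0 j x : 0 <= psi j x by apply: sumr_ge0.
have psi1 x : \sum_j psi j x = 1.
  rewrite /psi (exchange_big_dep predT)//= -(phi1 x); apply: eq_bigr => i _.
  have [j Vj] := VU i; rewrite (big_pred1 j)// => j'.
  by rewrite Vj; apply/eqP/eqP => [/injU ->//|->].
have [j0 Vj0] := VU i0.
exists (size s), U, j0, psi; split => //.
  split; first by move=> j; have [i ->] := UV j.
  split.
    move=> x; have [i Vi] := covV x; have [j Vj] := VU i.
    by exists j; rewrite -Vj.
  by split => //; rewrite -Vj0.
split; first by move=> j; apply: cts_sum.
split => //; split => //; split; last first.
  apply/eqP; rewrite eq_le; apply/andP; split.
    by rewrite -(psi1 x0) (bigD1 j0)//= lerDl sumr_ge0.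
  by rewrite -phix0 /psi (bigD1 i0) ?Vj0//= lerDl sumr_ge0.
move=> j x cx.
have [//|nUx] := pselect (U j x).
(* If [x] is off [U j], it is off the closed support of each of the finitely many merged functions,
   so they all vanish near [x]. *)
have : \forall y \near x, forall i, V i = U j -> ~ 0 < phi i y.
  apply: filter_forall => i; have [Vj|Vj] := pselect (V i = U j); last by near=> y.
  have : nbhs x (~` closure [set x | 0 < phi i x]).
    apply: open_nbhs_nbhs; split; first by apply: closed_openC; exact: closed_closure.
    by move=> /clV; rewrite Vj.
  by apply: (@filterS _ (nbhs x)) => y cy _ py; apply: cy; exact: subset_closure.
move=> /cx [y [/= pj hy]]; move: pj; rewrite /psi big1 ?ltxx// => i /eqP Vj.
by apply/eqP; rewrite eq_le phi0 andbT leNgt; apply/negP/hy.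
Unshelve. all: by end_near. Qed.

Lemma finite_net e : 0 < e -> compact [set: X] ->
  exists s : seq X, forall x, exists2 c, c \in s & mdist c x < e.
Proof.
move=> e0 /compact_near_coveringP cX.
(* Compactness is applied to the filter of ever larger finite lists. *)
pose F := filter_from [set: seq X] (fun s0 => [set s : seq X | {subset s0 <= s}]).
have FF : Filter F.
  apply: filter_from_filter; first by exists [::].
  move=> s1 s2 _ _; exists (s1 ++ s2) => // s /= hs.
  by split => x xs; apply: hs; rewrite mem_cat xs ?orbT.
have [|s0 _ /(_ s0)] :=
  cX (seq X) F (fun s x => exists2 c, c \in s & mdist c x < e) FF.
- move=> x _; exists ([set y | mdist x y < e], [set s : seq X | x \in s]) => /=.
    split; first exact: mdist_near.
    by exists [:: x] => // s /=; apply; rewrite inE.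
  by move=> [y s] /= [xy xs]; exists x.
- by move=> /(_ (fun x => id)) h; exists s0 => x; exact: h.
Qed.

(** The members are balls around [x0] and the points of a finite net, with normalised bump
    functions. Every bump except the one at [x0] is capped by the distance to [x0], hence vanishes
    there; this gives the value 1 required at the base point. *)
Lemma small_cover e : 0 < e -> compact [set: X] ->
  exists m (U : 'I_m -> set X) i0 (phi : 'I_m -> X -> R),
    [/\ pointed_cover x0 U i0, pou_subordinate x0 U i0 phi &
        forall i x y, U i x -> U i y -> mdist x y < e].
Proof.
(* Bumps live in balls of radius [d] and members have radius [2 * d]: this leaves room for the
   closed supports and keeps distances within a member below [4 * d]. *)
move=> e0 cX; pose d := e / 4; have d0 : 0 < d by rewrite divr_gt0.
have [s hs] := finite_net d0 cX.
pose c (i : 'I_(size s).+1) := nth x0 (x0 :: s) i.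
pose psi (i : 'I_(size s).+1) x := if i == ord0 then Num.max 0 (d - mdist x0 x)
  else Num.min (mdist x0 x) (Num.max 0 (d - mdist (c i) x)).
pose V i := [set x | mdist (c i) x < 2 * d].
have cdist z : continuous (fun x : X => mdist z x).
  by apply: mdist_cts; [exact: cts_cst|exact: cts_id].
have cpsi i : continuous (psi i).
  by rewrite /psi; case: (i == ord0); cts; apply: cdist.
have psi0 i x : 0 <= psi i x.
  rewrite /psi; case: ifP => _; first by rewrite le_max lexx.
  by rewrite le_min mdist_ge0 le_max lexx.
have psiV i x : 0 < psi i x -> mdist (c i) x <= d.
  rewrite /psi; case: ifP => [/eqP ->|_]; first by rewrite lt_max ltxx /=; lra.
  by rewrite lt_min lt_max ltxx /= => /andP[_]; lra.
have spsi x : 0 < \sum_i psi i x.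
  suff [i pi] : exists i, 0 < psi i x.
    by rewrite (bigD1 i)//=; apply: ltr_pwDl => //; apply: sumr_ge0.
  (* Close to [x0] the first bump is positive; elsewhere the cap is positive, and so is the bump of
     a net point. *)
  have [xx|xx] := ltP (mdist x0 x) d.
    by exists ord0; rewrite /psi eqxx lt_max; apply/orP; right; lra.
  have [z zs zx] := hs x.
  have si : ((index z s).+1 < (size s).+1)%N by rewrite ltnS index_mem.
  exists (Ordinal si); rewrite /psi /= lt_min lt_max /c /= nth_index//.
  by rewrite (lt_le_trans d0 xx) /=; apply/orP; right; lra.
pose phi i x := psi i x / \sum_j psi j x.
have [||||k [U [j0 [phi' [covU pouU UV]]]]] := @pou_injective _ V ord0 phi.
- by move=> i; apply: open_lt; cts; apply: cdist.
- move=> x; have [z zs zx] := hs x.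
  have si : ((index z s).+1 < (size s).+1)%N by rewrite ltnS index_mem.
  by exists (Ordinal si); rewrite /V /c /= nth_index//; lra.
- by rewrite /V /c /= mdistxx; lra.
- split.
    move=> i; rewrite /phi; cts; first exact: cpsi.
    apply: ctsV; last exact: cts_sum.
    by move=> x; rewrite gt_eqF.
  split; first by move=> i x; rewrite divr_ge0// ltW.
  split; first by move=> x; rewrite -mulr_suml divff// gt_eqF.
  split.
    move=> i x cx; have : closed [set x | mdist (c i) x <= d].
      by apply: closed_le; cts; apply: cdist.
    move=> /closure_id ccl.
    have : closure [set x | mdist (c i) x <= d] x.
      apply: closure_subset cx => y /= py; apply: psiV.
      by move: py; rewrite /phi pmulr_lgt0// invr_gt0.
    by rewrite -ccl /V /=; lra.
  have -> : phi ord0 x0 = psi ord0 x0 / \sum_j psi j x0 by [].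
  rewrite [X in _ / X](bigD1 ord0)//= big1 ?addr0 ?divff//.
    by rewrite /psi eqxx mdistxx subr0 gt_eqF// lt_max d0 orbT.
  move=> i /negbTE i0; rewrite /psi i0 mdistxx; apply/min_idPl.
  by rewrite le_max lexx.
exists k, U, j0, phi'; split => // j x y; have [i ->] := UV j; rewrite /V /=.
have := metric_triangle x (c i) y; rewrite (metric_sym x (c i)) /d; lra.
Qed.

End SmallCover.

(** * Inverse limits of polyhedra *)

Section WithinProduct.
Context {R : realType}.

Lemma cvg_prod_topology (I : Type) (T : I -> topologicalType)
    (F : set_system (prod_topology T)) (y : prod_topology T) : Filter F ->
  (forall i, (fun z => z i) @ F --> y i) -> F --> y.
Proof.
move=> FF Fy; apply/cvg_sup => i A; rewrite nbhsE => -[B [oB By] BA].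
case: oB => C oC CB; apply: filterS BA _; rewrite -CB.
apply: (Fy i C); apply: open_nbhs_nbhs; split => //.
by move: By; rewrite -CB.
Qed.

Lemma within_cts_comp2 (T U V : topologicalType) (A : set T) (B : set U)
    (f : T -> U) (g : U -> V) :
  {within A, continuous f} -> (forall x, A x -> B (f x)) ->
  {within B, continuous g} -> {within A, continuous (fun x => g (f x))}.
Proof.
move=> /subspace_continuousP cf fAB /subspace_continuousP cg.
apply/subspace_continuousP => x Ax W nW.
have nW' : nbhs (f x) [set y | B y -> W (g y)] := cg _ (fAB _ Ax) W nW.
have := cf x Ax _ nW'; rewrite /nbhs /=.
by apply: (@filterS _ (nbhs x)) => y fy Ay; apply: fy => //; exact: fAB.
Qed.

Lemma within_prod (I : Type) (T : I -> topologicalType) (U : topologicalType)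
    (A : set U) (f : U -> prod_topology T) :
  (forall i, {within A, continuous (fun u => f u i)}) ->
  {within A, continuous f}.
Proof.
move=> cf; apply/subspace_continuousP => x Ax.
apply: cvg_prod_topology => i W nW.
by have /subspace_continuousP/(_ x Ax W nW) := cf i.
Qed.

Lemma ghtp_comp (T U : topologicalType) (S : set T) (y0 : T) n
    (F G : 'rV[R]_n -> T) (k : T -> U) :
  {within S, continuous k} -> ghtp S y0 F G ->
  ghtp setT (k y0) (fun t => k (F t)) (fun t => k (G t)).
Proof.
move=> ck [H [cH SH oH HF HG]]; exists (fun p => k (H p)); split => //.
- exact: within_cts_comp ck.
- by move=> s t /oH ->.
- by move=> t; rewrite HF.
- by move=> t; rewrite HG.
Qed.

End WithinProduct.

Lemma realization_vertex {R : realType} m (K : set {set 'I_m}) (p : 'rV[R]_m) :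
  simplicial_complex K -> realization K p ->
  exists v, realization K (vertex v : 'rV[R]_m).
Proof.
move=> [_ Ksub] [p0 [p1 Kp]].
have /finset.set0Pn [v] := support_neq0 p0 p1; rewrite inE => pv.
have v0 i : 0 <= (vertex v : 'rV[R]_m) ord0 i by rewrite mxE.
have v1 : \sum_i (vertex v : 'rV[R]_m) ord0 i = 1.
  rewrite (bigD1 v)//= mxE eqxx big1 ?addr0// => i /negbTE iv.
  by rewrite mxE iv.
exists v; split => //; split => //; apply: (Ksub _ _ Kp); last exact: support_neq0.
apply/fintype.subsetP => i; rewrite !inE mxE.
by have [->|] := eqVneq i v; rewrite ?ltxx.
Qed.

(** * Pushing nearby points into a polyhedron *)

Section Shrink.
Context {R : realType} (m : nat) (K : set {set 'I_m}).
Hypothesis Kcx : simplicial_complex K.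

(** On the affine hull of the simplex the maximum in the denominator is
    attained by the sum; it only serves global continuity. *)
Definition shrink (eta : R) (u : 'rV[R]_m) : 'rV[R]_m :=
  \row_i (Num.max 0 (u ord0 i - eta) /
    Num.max (1 - m%:R * eta) (\sum_j Num.max 0 (u ord0 j - eta))).

Lemma shrink_cts eta : m%:R * eta < 1 -> continuous (shrink eta).
Proof.
move=> me; apply: cts_row => i; cts.
apply: ctsV; first by move=> u; rewrite gt_eqF// lt_max subr_gt0 me.
by cts; apply: cts_sum => j; cts.
Qed.

Variables (eta : R) (u p : 'rV[R]_m).
Hypotheses (eta0 : 0 < eta) (me : m%:R * eta < 1) (Kp : realization K p).
Hypotheses (u1 : \sum_i u ord0 i = 1).
Hypothesis up : forall i, `|u ord0 i - p ord0 i| < eta.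

Let x i := Num.max 0 (u ord0 i - eta).
Let s := \sum_i x i.

Let x0 i : 0 <= x i. Proof. by rewrite /x le_max lexx. Qed.

Let s_ge : 1 - m%:R * eta <= s.
Proof.
have -> : 1 - m%:R * eta = \sum_i (u ord0 i - eta).
  by rewrite sumrB u1 sumr_const card_ord mulr_natl.
by apply: ler_sum => i _; rewrite /x le_max lexx orbT.
Qed.

Let x_le i : x i <= p ord0 i.
Proof.
have [p0 _] := Kp; rewrite /x ge_max p0 /=.
by have := up i; rewrite ltr_norml => /andP[_]; lra.
Qed.

Let s0 : 0 < s. Proof. by apply: lt_le_trans s_ge; rewrite subr_gt0. Qed.

Let s_le1 : s <= 1.
Proof. by have [_ [<- _]] := Kp; apply: ler_sum. Qed.

Let shrinkE i : shrink eta u ord0 i = x i / s.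
Proof. by rewrite mxE -/s (max_idPr s_ge). Qed.

(** A coordinate of [u] that exceeds [eta] belongs to the support of [p], so subtracting [eta]
    leaves a face of that simplex, nonempty because [m%:R * eta < 1]. Renormalising does not change
    the support. *)
Lemma shrink_realization : realization K (shrink eta u).
Proof.
have [_ [_ Ksupp]] := Kp; have [_ Ksub] := Kcx.
have y0 i : 0 <= shrink eta u ord0 i by rewrite shrinkE divr_ge0// ltW.
have y1 : \sum_i shrink eta u ord0 i = 1.
  by under eq_bigr do rewrite shrinkE; rewrite -mulr_suml divff// gt_eqF.
split => //; split => //; apply: (Ksub _ _ Ksupp); last exact: support_neq0.
apply/fintype.subsetP => i; rewrite !inE shrinkE pmulr_lgt0 ?invr_gt0// => xi.
exact: lt_le_trans (x_le i).
Qed.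

(** A truncated coordinate lies between that of [p] minus [2 * eta] and that of [p]; dividing by the
    total, which is at least [1 - m%:R * eta], raises it by at most [m%:R * eta]. *)
Lemma shrink_dist i : `|shrink eta u ord0 i - p ord0 i| <= (m%:R + 2) * eta.
Proof.
rewrite shrinkE.
have xs : x i / s <= 1.
  by rewrite ler_pdivrMr// mul1r /s (bigD1 i)//= lerDl sumr_ge0.
have xs0 : 0 <= x i / s by rewrite divr_ge0// ltW.
have xE : x i / s - x i = (x i / s) * (1 - s).
  by rewrite mulrBr mulr1 divfK// gt_eqF.
have h1 : 0 <= x i / s - x i by rewrite xE mulr_ge0// subr_ge0.
have h2 : x i / s - x i <= m%:R * eta.
  rewrite xE; apply: (@le_trans _ _ (1 * (1 - s))).
    by apply: ler_wpM2r => //; rewrite subr_ge0.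
  by have := s_ge; lra.
have h3 : p ord0 i - 2 * eta <= x i.
  by rewrite /x le_max; have := up i; rewrite ltr_norml => /andP[h _];
    apply/orP; right; lra.
have h4 := x_le i.
have h5 : 0 <= m%:R * eta by rewrite mulr_ge0// ltW.
by rewrite ler_norml; apply/andP; split; lra.
Qed.

End Shrink.

(** Only one coordinate survives the truncation, and renormalising returns it to 1. This is why a
    vertex is taken as base point in the polyhedron. *)
Lemma shrink_vertex {R : realType} m (eta : R) (i : 'I_m) :
  0 < eta < 1 -> m%:R * eta < 1 -> shrink eta (vertex i) = vertex i.
Proof.
move=> /andP[e0 e1] me; apply/rowP => j; rewrite !mxE.
have E k : Num.max 0 ((vertex (R := R) i) ord0 k - eta) = (k == i)%:R * (1 - eta).
  rewrite mxE; case: (k == i).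
    by rewrite mulr1n mul1r; apply/max_idPr; lra.
  by rewrite mulr0n mul0r; apply/max_idPl; lra.
under eq_bigr do rewrite E.
have := E j; rewrite mxE => ->.
rewrite -mulr_suml (bigD1 i)//= eqxx big1 ?addr0 ?mul1r; last first.
  by move=> k /negbTE ->.
rewrite (max_idPr _) ?mulfK//; first by rewrite subr_eq0 eq_sym lt_eqF.
rewrite lerD2l lerN2 ler_peMl ?(ltW e0)// ler1n.
by case: m i {E j me} => // -[].
Qed.

(** * Sections of the projections of an inverse limit *)

Section InverseLimit.
Context {R : realType} (m : nat -> nat) (K : forall j, set {set 'I_(m j)})
  (r : forall j, 'rV[R]_(m j.+1) -> 'rV[R]_(m j))
  (s : forall j, 'rV[R]_(m j) -> 'rV[R]_(m j.+1)).
Arguments K : clear implicits.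
Arguments r : clear implicits.
Arguments s : clear implicits.
Hypotheses
  (hr : forall j, {within realization (K j.+1), continuous r j} /\
                  r j @` realization (K j.+1) `<=` realization (K j))
  (hs : forall j, {within realization (K j), continuous s j} /\
                  s j @` realization (K j) `<=` realization (K j.+1) /\
                  (forall t, realization (K j) t -> r j (s j t) = t)).

Let P := prod_topology (fun j => 'rV[R]_(m j)).
Let L : set P := [set y | forall j, realization (K j) (y j) /\ r j (y j.+1) = y j].

(** The bonding maps are composed downwards, by induction on [j]. The entries of [b t] above stage
    [j] are placeholders, which [ascend] replaces. *)
Lemma descend j : exists b : 'rV[R]_(m j) -> P,
  [/\ forall i, (i <= j)%N -> {within realization (K j), continuous (fun t => b t i)} /\
        forall t, realization (K j) t -> realization (K i) (b t i),
      forall t, b t j = t,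
      forall t i, (i < j)%N -> r i (b t i.+1) = b t i &
      forall y, L y -> forall i, (i <= j)%N -> b (y j) i = y i].
Proof.
elim: j => [|j [b [bK bj br bL]]].
  exists (fun t => @eqtype.dfwith nat (fun k => 'rV[R]_(m k)) (fun k => 0) 0%N t); split => //.
  - move=> i; rewrite leqn0 => /eqP -> {i}; split.
      apply: continuous_subspaceT; under eq_fun do rewrite dfwith_in.
      exact: cts_id.
    by move=> t; rewrite dfwith_in.
  - by move=> t; rewrite dfwith_in.
  - by move=> y _ i; rewrite leqn0 => /eqP -> {i}; rewrite dfwith_in.
have [cr rK] := hr j.
pose b' (t : 'rV[R]_(m j.+1)) : P :=
  @eqtype.dfwith nat (fun k => 'rV[R]_(m k)) (b (r j t)) j.+1 t.
have b'j t : b' t j.+1 = t by rewrite /b' dfwith_in.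
have b'i t i : (i <= j)%N -> b' t i = b (r j t) i.
  by move=> ij; rewrite /b' dfwith_out// gtn_eqF.
exists b'; split => //.
- move=> i; rewrite leq_eqVlt => /orP[/eqP -> {i}|].
    split; last by move=> t; rewrite b'j.
    apply: (within_eq (f := fun t => t)); first by move=> t _; rewrite b'j.
    by apply: continuous_subspaceT; exact: cts_id.
  rewrite ltnS => ij; have [cb bKi] := bK i ij; split.
    apply: (within_eq (f := fun t => b (r j t) i)); first by move=> t _; rewrite b'i.
    apply: (within_cts_comp2 cr _ cb) => t Kt; apply: rK; by exists t.
  by move=> t Kt; rewrite b'i//; apply: bKi; apply: rK; exists t.
- move=> t i; rewrite ltnS leq_eqVlt => /orP[/eqP -> {i}|ij].
    by rewrite b'j b'i// bj.
  by rewrite !b'i ?(ltnW ij)// br.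
- move=> y Ly i; rewrite leq_eqVlt => /orP[/eqP -> {i}|]; first by rewrite b'j.
  by rewrite ltnS => ij; rewrite b'i// (Ly j).2 bL.
Qed.

Fixpoint ascend (j : nat) (y : P) (i : nat) : 'rV[R]_(m i) :=
  match i with
  | 0 => y 0
  | i'.+1 => if (i' < j)%N then y i'.+1 else s i' (ascend j y i')
  end.

Lemma ascend_low j y i : (i <= j)%N -> ascend j y i = y i.
Proof. by case: i => //= i ->. Qed.

Lemma ascend_high j y i : (j <= i)%N -> ascend j y i.+1 = s i (ascend j y i).
Proof. by move=> ji; rewrite [LHS]/= ltnNge ji. Qed.

(** Stages below [j] come from the bonding maps and later ones from the sections; [r (s t) = t]
    makes this a thread. By the last clause, projecting to stage [j] and coming back alters only
    stages beyond [j], hence little in the product topology when [j] is large. *)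
Lemma section_exists j : exists sg : 'rV[R]_(m j) -> P,
  [/\ {within realization (K j), continuous sg},
      forall t, realization (K j) t -> L (sg t),
      forall t, sg t j = t &
      forall y, L y -> forall i, (i <= j)%N -> sg (y j) i = y i].
Proof.
have [b [bK bj br bL]] := descend j.
pose sg t : P := ascend j (b t).
have sgK i : {within realization (K j), continuous (fun t => sg t i)} /\
    forall t, realization (K j) t -> realization (K i) (sg t i).
  have low k : (k <= j)%N ->
      {within realization (K j), continuous (fun t => sg t k)} /\
      forall t, realization (K j) t -> realization (K k) (sg t k).
    move=> kj; have [cb bKk] := bK k kj; split.
      by apply: within_eq cb => t _; rewrite /sg ascend_low.
    by move=> t Kt; rewrite /sg ascend_low//; exact: bKk.
  elim: i => [|i [ci Ki]]; first exact: low.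
  have [|ji] := ltnP i j; first exact: low.
  have [cs [sK _]] := hs i; split.
    apply: (within_eq (f := fun t => s i (sg t i))).
      by move=> t _; rewrite /sg ascend_high.
    exact: (within_cts_comp2 ci Ki cs).
  by move=> t Kt; rewrite /sg ascend_high//; apply: sK; exists (sg t i) => //; exact: Ki.
exists sg; split.
- by apply: within_prod => i; case: (sgK i).
- move=> t Kt i; split; first by case: (sgK i) => _; apply.
  have [ij|ji] := ltnP i j; first by rewrite /sg !ascend_low ?(ltnW ij)// br.
  rewrite [sg t i.+1]ascend_high//.
  by have [_ [_ ->//]] := hs i; case: (sgK i) => _; apply.
- by move=> t; rewrite /sg ascend_low.
- by move=> y Ly i ij; rewrite /sg ascend_low// bL.
Qed.

End InverseLimit.

Lemma dep_choice I (T : I -> Type) (Q : forall i, T i -> Prop) :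
  (forall i, exists y, Q i y) -> exists f : forall i, T i, forall i, Q i (f i).
Proof.
by move=> h; exists (fun i => projT1 (cid (h i))) => i; exact: (projT2 (cid (h i))).
Qed.

(** [q] is the projection of the inverse limit to a late stage, [f] the
    composite of the later sections. *)
Lemma approximate_retraction (R : realType) (X : metricType R) :
  compact [set: X] -> @inv_limit_retract_polyhedra R X -> forall e : R, 0 < e ->
  exists m (K : set {set 'I_m}) (q : X -> 'rV[R]_m) (f : 'rV[R]_m -> X),
    [/\ simplicial_complex K, continuous q /\ forall x, realization K (q x),
        {within realization K, continuous f},
        forall t, realization K t -> q (f t) = t &
        forall x, mdist x (f (q x)) < e].
Proof.
move=> cX [m [K [r [s [Kcx [hr [hs [h [g [ch [Lh [gh [hg cg]]]]]]]]]]]]] e e0.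
have [sg hsg] := dep_choice (section_exists hr hs).
have e2 : 0 < e / 2 by rewrite divr_gt0.
move: cX => /compact_near_coveringP cX.
have chi i : continuous (fun x => h x i).
  exact: (cts_comp ch (@proj_continuous nat (fun j => 'rV[R]_(m j)) i)).
(* Near-covering compactness for the filter of large stages yields a single stage that works at
   every point. *)
have [|j _ hj] := cX nat \oo (fun j x => mdist x (g (sg j (h x j))) < e) _.
  move=> x _.
  have cgx : nbhs (h x) [set y |
      (forall j, realization (K j) (y j) /\ r j (y j.+1) = y j) ->
      mdist x (g y) < e / 2].
    have /subspace_continuousP/(_ (h x) (Lh x)) lim := cg.
    by apply: (lim [set z | mdist x z < e / 2]);
      rewrite /from_subspace gh; exact: mdist_near.
  (* Convergence is joint in the point and the stage: as soon as [i <= j], coordinate [i] is that of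
     [h p.1], which is continuous in the point. *)
  have sgcvg : (fun p : X * nat => sg p.2 (h p.1 p.2) : prod_topology _)
      @ filter_prod (nbhs x) \oo --> h x.
    apply: cvg_prod_topology => i W nW.
    exists ((fun x => h x i) @^-1` W, [set j | (i <= j)%N]).
      by split => /=; [exact: chi|exists i].
    move=> [x' j] /= [Wx ij]; have [_ _ _ ->//] := hsg j.
  have := sgcvg _ cgx => -[[A B] /= [nA nB] AB].
  exists (A `&` [set y | mdist x y < e / 2], B) => /=.
    by split => //; apply: filterI => //; exact: mdist_near.
  move=> [y j] /= [[Ay xy] Bj].
  have [_ LK _ _] := hsg j.
  have xg : mdist x (g (sg j (h y j))) < e / 2.
    by apply: (AB (y, j)) => //; apply: LK; case: (Lh y j).
  by have := metric_triangle y x (g (sg j (h y j))); rewrite (metric_sym y x); lra.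
have [csg LK sgj _] := hsg j.
exists (m j), (K j), (fun x => h x j), (fun t => g (sg j t)); split => //.
- by split => // x; case: (Lh x j).
- exact: (within_cts_comp2 csg LK cg).
- by move=> t Kt; rewrite hg//; exact: LK.
- by move=> x; apply: hj => /=.
Qed.

(** * Small fibres for inverse limits *)

(** The common target of both cases: in the nerve of a fine enough cover, homotopic images come only
    from loops that are close in [X]. *)
Definition small_fibres {R : realType} (X : metricType R) (x0 : X) (n : nat) :=
  forall e : R, 0 < e -> exists2 d : R, 0 < d &
  forall m (U : 'I_m -> set X) i0 (phi : 'I_m -> X -> R),
    pointed_cover x0 U i0 -> pou_subordinate x0 U i0 phi ->
    (forall i x y, U i x -> U i y -> mdist x y < d) ->
  forall F G : 'rV[R]_n -> X, gloop x0 F -> gloop x0 G ->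
    ghtp (realization (nerve U)) (vertex i0)
      (fun t => canonical_map phi (F t)) (fun t => canonical_map phi (G t)) ->
    @close R X x0 n e F G.

Lemma small_fibres_shape_open {R : realType} (X : metricType R) (x0 : X) n
    (A : set (@pin R X x0 n)) :
  compact [set: X] -> @small_fibres R X x0 n -> rho_open A -> shape_open A.
Proof.
move=> cX sf rA a Aa; have [e e0 he] := rA a Aa.
(* [close_rho] gives only a weak inequality, so half of [e] is used. *)
have e2 : 0 < e / 2 by rewrite divr_gt0.
have [d d0 hd] := sf _ e2.
have [m [U [i0 [phi [covU pouU mesh]]]]] := small_cover x0 d0 cX.
exists m, U, i0, phi; split => //; split => // b [al [be [aal [bbe H]]]].
apply: he; have [gal sal] := pin_gloop aal; have [gbe sbe] := pin_gloop bbe.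
apply: (@le_lt_trans _ _ (e / 2)); last by rewrite gtr_pMr// invf_lt1// ltr1n.
apply: (close_rho sal sbe gal gbe).
exact: (hd _ _ _ _ covU pouU mesh _ _ gal gbe (htp_rel_ghtp H)).
Qed.

Section Retract.
Context {R : realType} (X : metricType R) (x0 : X) (n : nat).

Lemma compact_unif_cts (T : metricType R) (V : normedModType R) (q : T -> V) e :
  compact [set: T] -> continuous q -> 0 < e ->
  exists2 d, 0 < d & forall x y : T, mdist x y < d -> `|q x - q y| < e.
Proof.
move=> cT cq e0; have e2 : 0 < e / 2 by rewrite divr_gt0.
have [|d d0 hd] := @compact_uniform R T setT
  (fun d x => forall y, mdist x y < d -> `|q x - q y| < e) cT; last first.
  by exists d => // x y; exact: hd.
move=> x _.
have /nbhs_mdist [d d0 hd] : nbhs x [set y | `|q x - q y| < e / 2].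
  by have /cvgrPdist_lt/(_ _ e2) := cq x.
exists (d / 2); first by rewrite divr_gt0.
have d2 : 0 < d / 2 by rewrite divr_gt0.
apply: (@filterS _ (nbhs x)) (mdist_near x d2) => z xz d' /andP[_ d'd] y zy.
rewrite -(subrKA (q x)); apply: le_lt_trans (ler_normD _ _) _.
rewrite [ltRHS]splitr; apply: ltrD; first by rewrite distrC; apply: hd; lra.
by apply: hd; have := metric_triangle x z y; lra.
Qed.

Lemma retract_small_fibres : compact [set: X] -> @path_connected R X ->
  (0 < n)%N -> @inv_limit_retract_polyhedra R X -> @small_fibres R X x0 n.
Proof.
move=> cX pX n0 invX e e0.
have e2 : 0 < e / 2 by rewrite divr_gt0.
have [M [K [q [f [Kcx [cq qK] cf qf fq]]]]] := approximate_retraction cX invX e2.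
have [v Kv] := realization_vertex Kcx (qK x0).
(* The map [f] is continuous only on the polyhedron; its modulus at the points [q x] is made uniform
   by compactness of [X]. *)
have [d d0 hd] : exists2 d : R, 0 < d & forall x t, realization K t ->
    `|q x - t| < d -> mdist (f (q x)) (f t) < e / 2.
  have e4 : 0 < e / 4 by rewrite divr_gt0.
  have [|d d0 hd] := @compact_uniform R X setT (fun d x => forall t,
    realization K t -> `|q x - t| < d -> mdist (f (q x)) (f t) < e / 2) cX;
    last by exists d => // x; exact: hd.
  move=> x _.
  have /subspace_continuousP/(_ (q x) (qK x)) lim := cf.
  have /nbhs_ballP [d /= d0 hd] : nbhs (q x) [set t | realization K t ->
      mdist (f (q x)) (f t) < e / 4].
    exact: (lim _ (mdist_near _ e4)).
  rewrite -ball_normE in hd.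
  have d2 : 0 < d / 2 by rewrite divr_gt0.
  exists (d / 2) => //.
  have nx : nbhs x [set z | `|q x - q z| < d / 2].
    by have /cvgrPdist_lt/(_ _ d2) := cq x.
  apply: (@filterS _ (nbhs x)) nx => z /= xz d' /andP[_ d'd] t Kt zt.
  have h1 : mdist (f (q x)) (f (q z)) < e / 4.
    by apply: hd => //=; lra.
  have h2 : mdist (f (q x)) (f t) < e / 4.
    apply: hd => //=; rewrite -(subrKA (q z)).
    by apply: le_lt_trans (ler_normD _ _) _; lra.
  have := metric_triangle (f (q z)) (f (q x)) (f t).
  by rewrite (metric_sym (f (q z)) (f (q x))); lra.
(* Chosen so that [M%:R * eta < 1], [eta < 1], and the displacement [(M%:R + 2) * eta] of
   [shrink_dist] stays below [d]. *)
pose eta : R := Num.min d 1 / (M%:R + 3).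
have M0 : 0 <= M%:R :> R by [].
have M3 : 0 < M%:R + 3 :> R by lra.
have etaE : (M%:R + 3) * eta = Num.min d 1 by rewrite mulrC divfK// gt_eqF.
have m0 : 0 < Num.min d 1 by rewrite lt_min d0 ltr01.
have eta0 : 0 < eta by rewrite divr_gt0.
have Meta0 : 0 <= M%:R * eta by rewrite mulr_ge0// ltW.
have etad : (M%:R + 3) * eta <= d by rewrite etaE ge_min lexx.
have eta1' : (M%:R + 3) * eta <= 1 by rewrite etaE ge_min lexx orbT.
have Meta : M%:R * eta < 1 by lra.
have eta1 : eta < 1 by lra.
have eta2 : 0 < eta / 2 by rewrite divr_gt0.
(* Within a member of the cover [q] varies by less than [eta / 2], which leaves a strict bound by
   [eta] after averaging. *)
have [mesh mesh0 hmesh] := @compact_unif_cts X 'rV[R]_M q _ cX cq eta2.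
exists mesh => // m U i0 phi [_ [covU _]] pouU meshU F G gF gG FG.
pose y0 := f (vertex v).
(* Each member containing [y0] is sampled at [y0], so that the final map fixes [y0]. An empty member
   also gets [y0], as a default. *)
have [y hy] : exists y : 'I_m -> X, forall i,
    (U i y0 -> y i = y0) /\ forall x, U i x -> U i (y i).
  apply: (@dep_choice _ (fun=> X)
    (fun i y => (U i y0 -> y = y0) /\ forall x, U i x -> U i y)).
  move=> i; have [Uy|nUy] := pselect (U i y0); first by exists y0.
  have [[x Ux]|nU] := pselect (exists x, U i x); first by exists x.
  by exists y0; split => // x Ux; case: nU; exists x.
pose u (tau : 'rV[R]_m) : 'rV[R]_M := \row_k \sum_i tau ord0 i * q (y i) ord0 k.
have cu : continuous u.
  by apply: cts_row => k; apply: cts_sum => i; cts.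
(* Each sample [y i] of positive weight shares the member [U i] with [x], so the average [u tau] is
   coordinatewise close to [q x], and the properties of [shrink] apply with [q x] as the nearby
   point of the polyhedron. *)
have uq (tau : 'rV[R]_m) x : (forall i, 0 <= tau ord0 i) ->
    \sum_i tau ord0 i = 1 -> (forall i, 0 < tau ord0 i -> U i x) ->
    [/\ realization K (shrink eta (u tau)) &
        mdist (f (q x)) (f (shrink eta (u tau))) < e / 2].
  move=> t0 t1 tU.
  have u1 : \sum_k u tau ord0 k = 1.
    under eq_bigr do rewrite mxE.
    rewrite exchange_big /= -[RHS]t1; apply: eq_bigr => i _.
    by rewrite -mulr_sumr; have [_ [-> _]] := qK (y i); rewrite mulr1.
  have ux k : `|u tau ord0 k - q x ord0 k| < eta.
    have -> : u tau ord0 k - q x ord0 k =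
        \sum_i tau ord0 i * (q (y i) ord0 k - q x ord0 k).
      rewrite mxE; under [RHS]eq_bigr do rewrite mulrBr.
      by rewrite sumrB -mulr_suml t1 mul1r.
    apply: (@le_lt_trans _ _ (\sum_i tau ord0 i * (eta / 2))); last first.
      by rewrite -mulr_suml t1 mul1r; lra.
    apply: (le_trans (ler_norm_sum _ _ _)); apply: ler_sum => i _.
    rewrite normrM (ger0_norm (t0 i)).
    have [->|ti] := eqVneq (tau ord0 i) 0; first by rewrite !mul0r.
    have Ux : U i x by apply: tU; rewrite lt_neqAle eq_sym ti t0.
    apply: ler_wpM2l => //; have Uy := (hy i).2 _ Ux.
    apply: (@le_trans _ _ `|q (y i) - q x|); last exact/ltW/hmesh/(meshU i).
    by have := @coord_le_norm R M (q (y i) - q x) k; rewrite !mxE.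
  have Kt := shrink_realization Kcx Meta (qK x) u1 ux.
  split => //; apply: hd => //.
  have [->|nz] := eqVneq `|q x - shrink eta (u tau)| 0; first by [].
  have [|k ->] := @norm_coord R M (q x - shrink eta (u tau)).
    by rewrite lt_neqAle eq_sym nz normr_ge0.
  set w := shrink eta (u tau).
  have -> : (q x - w) ord0 k = q x ord0 k - w ord0 k by rewrite !mxE.
  by rewrite distrC; have := shrink_dist eta0 Meta (qK x) u1 ux k; rewrite -/w; lra.
pose S := realization (nerve U) : set 'rV[R]_m.
pose kappa tau := f (shrink eta (u tau)).
have SU tau : S tau -> exists x, forall i, 0 < tau ord0 i -> U i x.
  by move=> [_ [_ [_ [x hx]]]]; exists x => i ti; apply: hx; rewrite inE.
have ck : {within S, continuous kappa}.
  apply: (within_cts_comp2 _ _ cf).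
    by apply: continuous_subspaceT; apply: (cts_comp cu); exact: shrink_cts.
  move=> tau St; have [x hx] := SU _ St; have [t0 [t1 _]] := St.
  by have [] := uq tau x t0 t1 hx.
pose p := canonical_map phi.
have cp : continuous p := canonical_map_cts pouU.
have pS x : S (p x) := canonical_map_realization pouU x.
have pU x i : 0 < p x ord0 i -> U i x.
  by rewrite mxE; exact: (pou_support pouU).
have kp x : mdist x (kappa (p x)) < e.
  have [t0 [t1 _]] := pS x; have [_ h1] := uq (p x) x t0 t1 (pU x).
  have := fq x; have := metric_triangle x (f (q x)) (kappa (p x)).
  by rewrite /kappa; lra.
have ky0 : kappa (p y0) = y0.
  have [t0 [t1 _]] := pS y0.
  rewrite /kappa (_ : u (p y0) = vertex v) ?shrink_vertex ?eta0//.
  rewrite -[RHS](qf _ Kv) -/y0; apply/rowP => k; rewrite mxE.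
  rewrite -[RHS]mul1r -t1 mulr_suml; apply: eq_bigr => i _.
  have [->|ti] := eqVneq (p y0 ord0 i) 0; first by rewrite !mul0r.
  have Uy : U i y0 by apply: pU; rewrite lt_neqAle eq_sym ti t0.
  by rewrite (hy i).1.
have [g [cg [g0 g1]]] := pX y0 x0.
pose c x := g (clip x).
have cc : continuous c.
  apply: within_cts_comp cg; first exact: cts_clip.
  by move=> x; exact: clip_itv.
have c0 : c 0 = y0 by rewrite /c clip_le0.
have c1 : c 1 = x0 by rewrite /c clip_ge1.
pose c' x := c (1 - x).
have cc' : continuous c' by apply: (cts_comp _ cc); cts.
have c'0 : c' 0 = x0 by rewrite /c' subr0.
have c'1 : c' 1 = y0 by rewrite /c' subrr.
(* The loop is carried to the base point [y0], mapped by [kappa \o p], which fixes [y0] and moves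
   points by less than [e], and carried back; [transport_cancel] compares the result with [F0]. *)
have back F0 : gloop x0 F0 ->
    @close R X x0 n e F0 (transport c' (fun t => kappa (p (transport c F0 t)))) /\
    gloop x0 (transport c' (fun t => kappa (p (transport c F0 t)))).
  move=> gF0; have gc : gloop (c 1) F0 by rewrite c1.
  have gcF : gloop (c' 1) (transport c F0).
    by rewrite c'1 -c0; exact: transport_gloop.
  have gk : gloop (c' 1) (fun t => kappa (p (transport c F0 t))).
    case: gcF => ccF cF0; split.
      apply: within_cts_comp ck => //; exact: (cts_comp ccF).
    by move=> t /cF0 ->; rewrite c'1 ky0.
  have gt : gloop x0 (transport c' (fun t => kappa (p (transport c F0 t)))).
    by rewrite -c'0; exact: transport_gloop.
  split => //.
  have can := transport_cancel cc gc; rewrite c1 in can.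
  apply: (close_ghtp (ghtp_sym can) (ghtp_refl gt)).
  apply: close_pt => //; first exact: gloop_ghtp can.
  by apply: transport_dist.
have [clF gtF] := back _ gF; have [clG gtG] := back _ gG.
apply: (close_trans n0 clF); apply: (close_trans n0 _ (close_sym clG)).
set TG := transport c' (fun t => kappa (p (transport c G t))).
(* The middle link is a homotopy, so both sides may be represented by [TG]. The homotopy in the
   nerve is transported along [p \o c], mapped by [kappa], and transported back along [c']. *)
apply: (@close_ghtp _ _ _ _ e _ _ TG TG _ (ghtp_refl gtG)); last first.
  by apply: close_pt => // t; rewrite mdistxx.
rewrite -c'0; apply: transport_ghtp => //; rewrite c'1 -ky0.
apply: (ghtp_comp (F := fun t => p (transport c F t))
  (G := fun t => p (transport c G t)) ck).
have -> : (fun t => p (transport c F t)) =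
    transport (fun x => p (c x)) (fun t => p (F t)).
  by apply/funext => t; exact: transport_comp.
have -> : (fun t => p (transport c G t)) =
    transport (fun x => p (c x)) (fun t => p (G t)).
  by apply/funext => t; exact: transport_comp.
rewrite -c0; apply: (@transport_ghtp _ _ _ _ (fun x => p (c x))) => //.
  exact: (cts_comp cc).
by rewrite c1 /p (canonical_map_base pouU).
Qed.

End Retract.

(** * Extension over the skeleta of a grid *)

Section LocalContractibility.
Context {R : realType} (X : metricType R).

(** For [z] near [y], a sphere close to [z] is close to [y], so the neighbourhood [V] found at [y]
    serves all such [z]. Halving both constants absorbs the shift, and compactness gives a single
    [d]. *)
Lemma LC_uniform k e : compact [set: X] -> @LC R k X -> 0 < e ->
  exists2 d : R, 0 < d & forall (y : X) l (f : 'rV[R]_l.+1 -> X), (l <= k)%N ->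
    {within @sphere R l, continuous f} ->
    (forall v, @sphere R l v -> mdist y (f v) < d) ->
    exists g : 'rV[R]_l.+1 -> X, [/\ {within @disk R l, continuous g},
      forall v, @disk R l v -> mdist y (g v) < e &
      forall v, @sphere R l v -> g v = f v].
Proof.
move=> cX lc e0; pose P (d : R) y := forall l (f : 'rV[R]_l.+1 -> X), (l <= k)%N ->
    {within @sphere R l, continuous f} ->
    (forall v, @sphere R l v -> mdist y (f v) < d) ->
    exists g : 'rV[R]_l.+1 -> X, [/\ {within @disk R l, continuous g},
      forall v, @disk R l v -> mdist y (g v) < e &
      forall v, @sphere R l v -> g v = f v].
have [|d d0 hd] := @compact_uniform R X setT P cX; last first.
  by exists d => // y; exact: hd.
move=> y _; have e2 : 0 < e / 2 by rewrite divr_gt0.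
have [V [Vy [_ hV]]] := lc y _ (mdist_near y e2).
have [d d0 dV] := nbhs_mdist Vy.
have d2 : 0 < d / 2 by rewrite divr_gt0.
exists (d / 2) => //.
have nn : nbhs y ([set z | mdist y z < d / 2] `&` [set z | mdist y z < e / 2]).
  by apply: filterI; exact: mdist_near.
apply: (@filterS _ (nbhs y)) nn => z /= [yzd yze] d' /andP[_ d'd] l f lk cf fd.
have [|g [cg [gU gf]]] := hV l lk f cf.
  move=> _ [v Sv <-]; apply: dV.
  by have := fd v Sv; have := metric_triangle y z (f v); lra.
exists g; split => // v Dv.
have /= : mdist y (g v) < e / 2 by apply: gU; exists v.
by have := metric_triangle z y (g v); rewrite (metric_sym z y); lra.
Qed.

Lemma cts_sqrt (T : topologicalType) (f : T -> R) :
  continuous f -> continuous (fun x => Num.sqrt (f x)).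
Proof. by move=> cf; apply: (cts_comp cf); exact: sqrt_continuous. Qed.

(** The boundary values are carried to the sphere by [Phi], extended over the disk and pulled back
    by [Psi]. A cube of dimension [l] is bounded by a sphere of dimension one less, hence the range
    up to [k.+1]. As [Psi] sends every point into the disk, the extension is global. *)
Lemma LC_cube k e : compact [set: X] -> @LC R k X -> 0 < e ->
  exists2 d : R, 0 < d & forall (y : X) l (f : 'rV[R]_l -> X), (0 < l <= k.+1)%N ->
    {within @cube_boundary R l, continuous f} ->
    (forall v, @cube_boundary R l v -> mdist y (f v) < d) ->
    exists g : 'rV[R]_l -> X, [/\ continuous g, forall v, mdist y (g v) < e &
      forall v, @cube_boundary R l v -> g v = f v].
Proof.
move=> cX lc e0; have [d d0 hd] := LC_uniform cX lc e0.
exists d => // y [//|l] f /andP[_]; rewrite ltnS => lk cf fd.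
pose w (t : 'rV[R]_l.+1) : 'rV[R]_l.+1 := \row_i (2 * t ord0 i - 1).
pose n2 (v : 'rV[R]_l.+1) := Num.sqrt (\sum_i v ord0 i ^+ 2).
(* With the cube rescaled to side 2 about the origin, this is the radial retraction onto the
   inscribed disk; it sends the boundary of the cube to the sphere. *)
pose Psi (t : 'rV[R]_l.+1) : 'rV[R]_l.+1 := \row_i (w t ord0 i / Num.max 1 (n2 (w t))).
(* A lower bound for the sup norm on the unit sphere: it keeps the denominator of [Phi] positive
   everywhere without changing it on the sphere. *)
pose c : R := l.+1%:R^-1.
have c0 : 0 < c by rewrite invr_gt0.
pose Phi (v : 'rV[R]_l.+1) : 'rV[R]_l.+1 := \row_i ((v ord0 i / Num.max c `|v| + 1) / 2).
have sq0 (v : 'rV[R]_l.+1) : 0 <= \sum_i v ord0 i ^+ 2.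
  by apply: sumr_ge0 => i _; exact: sqr_ge0.
have cw : continuous w by apply: cts_row => i; cts.
have cn2 : continuous n2.
  apply: cts_sqrt; apply: cts_sum => i.
  by change (continuous (fun v : 'rV[R]_l.+1 => v ord0 i * v ord0 i)); cts.
have cPsi : continuous Psi.
  apply: cts_row => i; cts.
  apply: ctsV; first by move=> t; rewrite gt_eqF// lt_max ltr01.
  by cts; exact: (cts_comp cw).
have cPhi : continuous Phi.
  apply: cts_row => i; cts.
  apply: ctsV; first by move=> t; rewrite gt_eqF// lt_max c0.
  by cts; apply: (@cts_norm _ _ 'rV[R]_l.+1); exact: cts_id.
have PsiD t : disk (Psi t).
  rewrite /disk /=; under eq_bigr do rewrite mxE exprMn.
  rewrite -mulr_suml -[X in X * _](sqr_sqrtr (sq0 _)) -exprMn.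
  apply: exprn_ile1; first by rewrite mulr_ge0 ?sqrtr_ge0// invr_ge0 le_max ler01.
  by rewrite ler_pdivrMr ?lt_max ?ltr01// mul1r le_max lexx orbT.
have PhiB v : sphere v -> cube_boundary (Phi v).
  rewrite /sphere /= => v1.
  have vi i : `|v ord0 i| <= `|v| := coord_le_norm v i.
  have cv : c <= `|v|.
    rewrite leNgt; apply/negP => vc.
    have : \sum_i v ord0 i ^+ 2 < 1; last by rewrite v1 ltxx.
    apply: (@le_lt_trans _ _ (\sum_(i < l.+1) `|v| ^+ 2)).
      by apply: ler_sum => i _; rewrite -(real_normK (num_real _)) lerXn2r ?nnegrE.
    rewrite sumr_const card_ord -mulr_natl expr2 mulrA.
    have lv : l.+1%:R * `|v| < 1 by rewrite -ltr_pdivlMl// mulr1.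
    have v1' : `|v| < 1 by apply: (lt_le_trans vc); rewrite invf_le1// ler1n.
    have v0 : 0 <= `|v| by [].
    have lv0 : 0 <= l.+1%:R * `|v| by rewrite mulr_ge0.
    by nra.
  have v0 : 0 < `|v| := lt_le_trans c0 cv.
  have q i : `|v ord0 i / `|v| | <= 1.
    by rewrite normrM normfV normr_id ler_pdivrMr// mul1r.
  split.
    move=> i; rewrite mxE (max_idPr cv); have := q i; rewrite ler_norml; lra.
  have [i vE] := norm_coord v0; exists i; rewrite mxE (max_idPr cv).
  have [h|h] := leP 0 (v ord0 i).
    right; rewrite vE ger0_norm// divff; first by lra.
    by move: v0; rewrite vE ger0_norm// => /gt_eqF ->.
  left; rewrite vE ltr0_norm// invrN mulrN divff; first by lra.
  by rewrite lt_eqF.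
(* [Psi] maps the cube to the disk, and [Phi] inverts it on the boundary. *)
have BK t : cube_boundary t -> sphere (Psi t) /\ Phi (Psi t) = t.
  move=> Bt; have [ct _] := Bt.
  have wn : `|w t| = 1.
    have wr : w t = 2 *: t - const_mx 1 by apply/rowP => i; rewrite !mxE.
    apply/eqP; rewrite eq_le wr; apply/andP; split; last first.
      exact/out_radius/out_boundary.
    rewrite -wr; have [->|nz] := eqVneq `|w t| 0; first exact: ler01.
    have [|i ->] := @norm_coord R _ (w t).
      by rewrite lt_neqAle eq_sym nz normr_ge0.
    by rewrite mxE ler_norml; have := ct i; lra.
  have wi i : `|w t ord0 i| <= n2 (w t).
    rewrite -sqrtr_sqr ler_wsqrtr// (bigD1 i)//= lerDl.
    by apply: sumr_ge0 => j _; exact: sqr_ge0.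
  have n21 : 1 <= n2 (w t).
    have [|i wE] := @norm_coord R _ (w t); first by rewrite wn ltr01.
    by rewrite -wn wE.
  have n20 : 0 < n2 (w t) := lt_le_trans ltr01 n21.
  have PsiE : Psi t = (n2 (w t))^-1 *: w t.
    by apply/rowP => i; rewrite !mxE (max_idPr n21) mulrC.
  split.
    rewrite /sphere /=; under eq_bigr do rewrite PsiE mxE exprMn.
    rewrite -mulr_sumr -[X in _ * X](sqr_sqrtr (sq0 _)) -exprMn mulVf ?expr1n//.
    by rewrite gt_eqF.
  have PsiN : `|Psi t| = (n2 (w t))^-1.
    by rewrite PsiE normrZ wn mulr1 ger0_norm// invr_ge0 ltW.
  have cPs : c <= `|Psi t|.
    rewrite PsiN lef_pV2 ?posrE//.
    have s1 : \sum_i w t ord0 i ^+ 2 <= l.+1%:R.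
      rewrite -[leRHS]mulr1 mulr_natl -[in leRHS](card_ord l.+1) -sumr_const.
      apply: ler_sum => i _; rewrite -(real_normK (num_real _)) expr_le1//.
      by rewrite -wn coord_le_norm.
    apply: (@le_trans _ _ (Num.sqrt l.+1%:R)); first exact: ler_wsqrtr.
    rewrite -[leRHS]ger0_norm// -sqrtr_sqr ler_wsqrtr//.
    by rewrite expr2 ler_peMr// ler1n.
  apply/rowP => i; rewrite mxE (max_idPr cPs) PsiN PsiE !mxE.
  by field; rewrite gt_eqF.
have [||g [cg gD gS]] := hd y l (fun v => f (Phi v)) lk.
- by apply: (within_cts_comp2 _ PhiB cf); apply: continuous_subspaceT.
- by move=> v /PhiB; exact: fd.
exists (fun t => g (Psi t)); split.
- exact: within_cts_comp cg.
- by move=> t; exact: gD.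
- by move=> t /BK [St Pt]; rewrite gS// Pt.
Qed.

End LocalContractibility.

Lemma within_finite_closed (T U : topologicalType) (I : finType) (C : I -> set T)
    (f : T -> U) : (forall i, closed (C i)) ->
  (forall i, {within C i, continuous f}) ->
  {within [set x | exists i, C i x], continuous f}.
Proof.
move=> clC cf.
suff [_] : closed [set x | exists2 i, i \in enum I & C i x] /\
    {within [set x | exists2 i, i \in enum I & C i x], continuous f}.
  apply: continuous_subspaceW => x [i Ci]; exists i => //.
  by rewrite mem_enum.
elim: (enum I) => [|i s [clA cA]].
  rewrite (_ : [set x | _] = set0); last by apply/seteqP; split => // x [].
  by split; [exact: closed0|exact: continuous_subspace0].
rewrite (_ : [set x | _] = C i `|` [set x | exists2 i, i \in s & C i x]).
  by split; [exact: closedU|exact: withinU_continuous].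
apply/seteqP; split=> x /=.
  by move=> [j]; rewrite inE => /orP[/eqP ->|js] Cj; [left|right; exists j].
move=> [Ci|[j js Cj]]; first by exists i; rewrite ?inE ?eqxx.
by exists j; rewrite // inE js orbT.
Qed.

Lemma closed_forall (T : topologicalType) I (A : I -> set T) :
  (forall i, closed (A i)) -> closed [set x | forall i, A i x].
Proof.
move=> cA; rewrite (_ : mkset _ = \bigcap_(i in setT) A i).
  by apply: closed_bigI => i _; exact: cA.
by apply/seteqP; split => x /= h i => //; exact: h.
Qed.

Section Cells.
Context {R : realType} (n : nat).
Implicit Types (t : 'rV[R]_n) (z w : 'I_n -> int) (S : {set 'I_n}).

(** The cubical complex of the integer lattice: [cell z S] is the closed cell
    with lowest vertex [z] and free coordinates [S]; [fl t] and [fr t] give the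
    cell whose relative interior contains [t]. *)
Definition cell z S : set 'rV[R]_n := [set t | forall i,
  (i \in S -> (z i)%:~R <= t ord0 i <= (z i)%:~R + 1) /\
  (i \notin S -> t ord0 i = (z i)%:~R)].

Definition fl t : 'I_n -> int := fun i => Num.floor (t ord0 i).
Definition fr t : {set 'I_n} :=
  finset (fun i : 'I_n => (Num.floor (t ord0 i))%:~R != t ord0 i).

Definition cell_vertex z S w := forall i, w i = z i \/ (i \in S /\ w i = z i + 1).

Lemma floor_int (a : int) : Num.floor (a%:~R : R) = a.
Proof. by apply: floor_def; rewrite lexx ltr_int ltrDl. Qed.

Lemma floor_le_lt (x : R) : (Num.floor x)%:~R <= x < (Num.floor x)%:~R + 1.
Proof. by have := floor_itv x; rewrite intrD. Qed.

Lemma notin_fr t i : i \notin fr t -> t ord0 i = (fl t i)%:~R.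
Proof. by rewrite inE negbK => /eqP <-. Qed.

Lemma cell_fl t : cell (fl t) (fr t) t.
Proof.
move=> i; split; last exact: notin_fr.
by move=> _; have /andP[-> /ltW ->] := floor_le_lt (t ord0 i).
Qed.

Lemma cell_fr t z S : cell z S t -> fr t \subset S.
Proof.
move=> ct; apply/fintype.subsetP => i; rewrite inE; apply: contraNT => iS.
by rewrite (ct i).2// floor_int.
Qed.

(** The floor of a coordinate differs from [z i] only on the upper face, where that coordinate is an
    integer. *)
Lemma cell_coord t z S i : cell z S t ->
  fl t i = z i \/ [/\ i \in S, i \notin fr t & fl t i = z i + 1].
Proof.
move=> /(_ i) [cS cnS]; have [iS|iS] := boolP (i \in S); last first.
  by left; rewrite /fl cnS// floor_int.
have /andP[zt tz] := cS iS.
have [tz1|tz1] := eqVneq (t ord0 i) ((z i)%:~R + 1).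
  have fE : Num.floor (t ord0 i) = z i + 1.
    by rewrite tz1 -[1]/(1%:~R) -intrD floor_int.
  by right; split => //; rewrite inE negbK fE intrD tz1.
by left; apply: floor_def; rewrite zt intrD lt_neqAle tz1.
Qed.

Lemma cell_fr_eq t z S : cell z S t -> fr t = S -> fl t = z.
Proof.
move=> ct frS; apply/funext => i; case: (cell_coord i ct) => // -[iS].
by rewrite frS iS.
Qed.

Lemma cell_vertex_sub t z S w : cell z S t ->
  cell_vertex (fl t) (fr t) w -> cell_vertex z S w.
Proof.
move=> ct vw i; have frS := fintype.subsetP (cell_fr ct) i.
case: (cell_coord i ct) => [zi|[iS ifr zi]].
  by case: (vw i) => [->|[/frS iS ->]]; rewrite zi; [left|right].
by case: (vw i) => [->|[]]; [rewrite zi; right|rewrite (negbTE ifr)].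
Qed.

Lemma closed_cell z S : closed (cell z S).
Proof.
suff h i : closed [set t : 'rV[R]_n | (i \in S -> (z i)%:~R <= t ord0 i <= (z i)%:~R + 1) /\
    (i \notin S -> t ord0 i = (z i)%:~R)] by exact: closed_forall h.
have [iS|iS] := boolP (i \in S).
  rewrite (_ : [set x | _] = [set t : 'rV[R]_n | (z i)%:~R <= t ord0 i] `&`
      [set t | t ord0 i <= (z i)%:~R + 1]).
    by apply: closedI; apply: closed_le; cts.
  by apply/seteqP; split => t /= => [[/(_ isT)/andP[]]|[-> ->]].
rewrite (_ : [set x | _] = [set t : 'rV[R]_n | (z i)%:~R <= t ord0 i] `&`
    [set t | t ord0 i <= (z i)%:~R]).
  by apply: closedI; apply: closed_le; cts.
apply/seteqP; split => t /=; first by move=> [_ ->].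
by move=> [h1 h2]; split => // _; apply/eqP; rewrite eq_le h1 h2.
Qed.

Section Chart.
Variables (z : 'I_n -> int) (S : {set 'I_n}).

(** The coordinates of [v] are placed on the free coordinates of the cell: for [i] in [S] exactly
    one term of the sum survives, for other [i] none does. *)
Definition chart (v : 'rV[R]_#|S|) : 'rV[R]_n :=
  \row_i ((z i)%:~R + \sum_j (enum_val j == i)%:R * v ord0 j).

Definition chart_inv t : 'rV[R]_#|S| :=
  \row_j (t ord0 (enum_val j) - (z (enum_val j))%:~R).

Lemma chart_in v j : chart v ord0 (enum_val j) = (z (enum_val j))%:~R + v ord0 j.
Proof.
rewrite mxE (bigD1 j)//= eqxx mul1r big1 ?addr0// => k kj.
by rewrite (inj_eq enum_val_inj) (negbTE kj) mul0r.
Qed.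

Lemma chart_out v i : i \notin S -> chart v ord0 i = (z i)%:~R.
Proof.
move=> iS; rewrite mxE big1 ?addr0// => j _.
case: eqP => [ji|]; last by rewrite mul0r.
by move: iS; rewrite -ji enum_valP.
Qed.

Lemma in_chart i : i \in S -> exists j : 'I_#|S|, i = enum_val j.
Proof. by move=> iS; exists (enum_rank_in iS i); rewrite enum_rankK_in. Qed.

Lemma chart_cts : continuous chart.
Proof. by apply: cts_row => i; cts; apply: cts_sum => j; cts. Qed.

Lemma chart_inv_cts : continuous chart_inv.
Proof. by apply: cts_row => i; cts. Qed.

Lemma chart_cell v : cube v -> cell z S (chart v).
Proof.
move=> cv i; split; last exact: chart_out.
by move=> /in_chart [j ->]; rewrite chart_in; have := cv j; lra.
Qed.

Lemma chart_inv_cube t : cell z S t -> cube (chart_inv t).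
Proof.
by move=> ct j; rewrite mxE; have := (ct (enum_val j)).1 (enum_valP j); lra.
Qed.

Lemma chart_invK t : cell z S t -> chart (chart_inv t) = t.
Proof.
move=> ct; apply/rowP => i; have [|iS] := boolP (i \in S).
  by move=> /in_chart [j ->]; rewrite chart_in mxE addrC subrK.
by rewrite chart_out// (ct i).2.
Qed.

Lemma chart_boundary v : cube_boundary v -> (#|fr (chart v)| < #|S|)%N.
Proof.
move=> [cv [j vj]]; apply: proper_card; apply/fintype.properP; split.
  exact: (cell_fr (chart_cell cv)).
exists (enum_val j); first exact: enum_valP.
rewrite inE negbK chart_in; apply/eqP.
by case: vj => ->; [rewrite addr0|rewrite -(intrD _ _ 1)]; rewrite floor_int.
Qed.

Lemma chart_inv_boundary t : cell z S t -> fr t != S -> cube_boundary (chart_inv t).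
Proof.
move=> ct frS; split; first exact: chart_inv_cube.
have : ~~ (S \subset fr t).
  by apply: contra frS => h; rewrite finset.eqEsubset (cell_fr ct) h.
move=> /fintype.subsetPn [_ /in_chart [j ->] jfr]; exists j.
rewrite mxE (notin_fr jfr).
by case: (cell_coord (enum_val j) ct) => [->|[_ _ ->]];
  [left; rewrite subrr|right; rewrite intrD addrC addKr].
Qed.

(** The boundary of the cube is covered by finitely many closed facets, each of which [chart] sends
    into a cell with one free coordinate less. *)
Lemma chart_boundary_cts (T : topologicalType) (G : 'rV[R]_n -> T) :
  (forall z' S', (#|S'| < #|S|)%N -> {within cell z' S', continuous G}) ->
  {within @cube_boundary R #|S|, continuous (fun v => G (chart v))}.
Proof.
move=> cG; pose C (p : 'I_#|S| * bool) : set 'rV[R]_#|S| :=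
  [set v | cube v /\ v ord0 p.1 = p.2%:R].
suff : {within [set v | exists p, C p v], continuous (fun v => G (chart v))}.
  apply: continuous_subspaceW => v [cv [j vj]].
  by case: vj => vj; [exists (j, false)|exists (j, true)].
apply: within_finite_closed => [[j b]|[j b]].
  rewrite (_ : C _ = [set v | forall i, 0 <= v ord0 i <= 1] `&`
     ([set v | v ord0 j <= b%:R] `&` [set v | b%:R <= v ord0 j])).
    apply: closedI; last by apply: closedI; apply: closed_le; cts.
    suff h i : closed [set v : 'rV[R]_#|S| | 0 <= v ord0 i <= 1].
      exact: closed_forall h.
    rewrite (_ : [set v | _] = [set v : 'rV[R]_#|S| | 0 <= v ord0 i] `&`
       [set v | v ord0 i <= 1]); last by apply/seteqP; split => v /andP.
    by apply: closedI; apply: closed_le; cts.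
  apply/seteqP; split => v /= [cv]; first by move=> ->; rewrite lexx.
  by move=> [h1 h2]; split => //; apply/eqP; rewrite eq_le h1 h2.
(* On the facet where coordinate [j] is 1 the lowest vertex moves up by one in that direction. *)
pose z' i := if i == enum_val j then z i + b%:Z else z i.
have cS : (#|S :\ enum_val j| < #|S|)%N.
  by rewrite [ltnRHS](cardsD1 (enum_val j)) enum_valP.
apply: (within_cts_comp2 _ _ (cG z' _ cS)).
  by apply: continuous_subspaceT; exact: chart_cts.
move=> v [cv /= vj] i; have ci := chart_cell cv i; rewrite !inE /z'.
case: eqP => [->|_] /=; last exact: ci.
by split => // _; rewrite chart_in vj intrD.
Qed.

End Chart.

End Cells.

Section Skeleton.
Context {R : realType} (X : metricType R) (x0 : X) (n : nat).
Implicit Types (t : 'rV[R]_n) (z w : 'I_n -> int) (S : {set 'I_n}).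
Hypotheses (cX : compact [set: X]) (lcX : @LC R n.-1 X).

(** Two steps are enough to compare any vertex near [t] with [fl t]. *)
Definition fine_grid (d : R) (g : ('I_n -> int) -> X) :=
  forall z w, (forall i, `|z i - w i| <= 2) -> mdist (g z) (g w) < d.

Definition near_vertex t z := forall i, `|t ord0 i - (z i)%:~R| <= 1.

Lemma near_vertex_fl t z : near_vertex t z -> forall i, `|z i - fl t i| <= 2.
Proof.
move=> tz i; have := tz i; rewrite /fl; have := floor_le_lt (t ord0 i).
rewrite ler_norml => /andP[h1 h2] /andP[h3 h4].
have : `|(z i - Num.floor (t ord0 i))%:~R| <= (2%:~R : R).
  by rewrite intrB ler_norml; apply/andP; split; lra.
by rewrite -intr_norm ler_int.
Qed.

Lemma cell_near t z S : cell z S t -> near_vertex t z.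
Proof.
move=> ct i; have [iS|iS] := boolP (i \in S).
  by have /andP[h1 h2] := (ct i).1 iS; rewrite ler_norml; apply/andP; split; lra.
by rewrite (ct i).2// subrr normr0.
Qed.

(** The last clause will put the extension at [x0] on the boundary of the scaled cube, where all
    vertices of a carrier are sent to [x0]. *)
Definition skeleton_ext (k : nat) (eta : R) (g : ('I_n -> int) -> X)
    (G : 'rV[R]_n -> X) :=
  [/\ forall z S, (#|S| <= k)%N -> {within cell z S, continuous G},
      forall t, (#|fr t| <= k)%N -> forall z, near_vertex t z ->
        mdist (g z) (G t) < eta &
      forall t, (#|fr t| <= k)%N ->
        (forall w, cell_vertex (fl t) (fr t) w -> g w = x0) -> G t = x0].

(** Induction on the dimension: the boundary of a new cell is mapped close to the value at its
    lowest vertex, so [LC_cube] fills it. Tolerances are chosen backwards, from the last skeleton to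
    the vertices. *)
Lemma skeleton_exists k eta : (k <= n)%N -> 0 < eta ->
  exists2 d : R, 0 < d & forall g, fine_grid d g ->
    exists G, skeleton_ext k eta g G.
Proof.
elim: k eta => [|k IH] eta kn eta0.
  exists eta => // g fg; exists (fun t => g (fl t)); split.
  - move=> z S S0; apply: (within_eq (f := fun=> g z)); last first.
      by apply: continuous_subspaceT; exact: cts_cst.
    move=> t ct; rewrite (cell_fr_eq ct)//; apply/eqP.
    rewrite eqEcard (cell_fr ct) /=; exact: leq_trans S0 _.
  - by move=> t _ z /near_vertex_fl tz; apply: fg.
  - by move=> t _; apply => i; left.
have e2 : 0 < eta / 2 by rewrite divr_gt0.
have [d0 d00 hd0] := LC_cube cX lcX e2.
have m0 : 0 < Num.min d0 eta by rewrite lt_min d00 eta0.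
have [d1 d10 hd1] := IH _ (ltnW kn) m0.
exists (Num.min d1 (eta / 2)); first by rewrite lt_min d10 e2.
move=> g fg.
have fg1 : fine_grid d1 g.
  by move=> z w zw; have := fg z w zw; rewrite lt_min => /andP[].
have fg2 : fine_grid (eta / 2) g.
  by move=> z w zw; have := fg z w zw; rewrite lt_min => /andP[].
have [G [cG dG xG]] := hd1 g fg1.
(* Fillings of all cells are chosen at once; a cell whose vertices all go to [x0] gets the constant
   map. *)
have [E hE] : exists E : ('I_n -> int) * {set 'I_n} -> 'rV[R]_n -> X,
  forall p : ('I_n -> int) * {set 'I_n}, #|p.2| = k.+1 -> [/\ continuous (E p),
    forall t, cell p.1 p.2 t -> fr t != p.2 -> E p t = G t,
    forall t, mdist (g p.1) (E p t) < eta / 2 &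
    (forall w, cell_vertex p.1 p.2 w -> g w = x0) -> forall t, E p t = x0].
  apply: (@dep_choice _ (fun=> 'rV[R]_n -> X) (fun (p : ('I_n -> int) * {set 'I_n}) Ep =>
    #|p.2| = k.+1 -> [/\ continuous Ep,
    forall t, cell p.1 p.2 t -> fr t != p.2 -> Ep t = G t,
    forall t, mdist (g p.1) (Ep t) < eta / 2 &
    (forall w, cell_vertex p.1 p.2 w -> g w = x0) -> forall t, Ep t = x0])).
  move=> [z S] /=.
  have [Sk|Sk] := eqVneq #|S| k.+1; last first.
    by exists (fun=> x0) => h; rewrite h eqxx in Sk.
  have frk t : cell z S t -> fr t != S -> (#|fr t| <= k)%N.
    move=> ct frS; rewrite -ltnS -Sk; apply: proper_card.
    by rewrite finset.properEneq frS (cell_fr ct).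
  have [allx|nallx] := pselect (forall w, cell_vertex z S w -> g w = x0).
    exists (fun=> x0) => _; split => //.
    - exact: cts_cst.
    - move=> t ct frS; rewrite xG ?frk// => w vw; apply: allx.
      exact: cell_vertex_sub vw.
    - by move=> t; rewrite allx ?mdistxx// => i; left.
  have [|||f [cf fd fE]] := hd0 (g z) #|S| (fun v => G (chart z v)).
  - by rewrite Sk /= (leq_trans kn)// leqSpred.
  - by apply: chart_boundary_cts => z' S' S'k; apply: cG; rewrite -ltnS -Sk.
  - move=> v Bv; have := chart_boundary z Bv; rewrite Sk ltnS => frv.
    have := dG _ frv z (cell_near (chart_cell z Bv.1)).
    by rewrite lt_min => /andP[].
  exists (fun t => f (chart_inv z S t)) => _; split => //.
  - by apply: (cts_comp _ cf); exact: chart_inv_cts.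
  - move=> t ct frS; rewrite fE; last exact: chart_inv_boundary.
    by rewrite chart_invK.
(* A point takes the filling of its carrier. On a closed cell of dimension [k.+1] this is the
   filling of that cell, since fillings extend [G]. *)
pose G' t := if #|fr t| == k.+1 then E (fl t, fr t) t else G t.
have G'lt t : (#|fr t| <= k)%N -> G' t = G t.
  by move=> frt; rewrite /G' ltn_eqF// ltnS.
exists G'; split.
- move=> z S; rewrite leq_eqVlt => /orP[/eqP Sk|]; last first.
    rewrite ltnS => Sk; apply: within_eq (cG z S Sk) => t ct; rewrite G'lt//.
    by apply: leq_trans Sk; apply: subset_leq_card; exact: (cell_fr ct).
  have [cE EG _ _] := hE (z, S) Sk.
  apply: (within_eq (f := E (z, S))); last exact: continuous_subspaceT.
  move=> t ct; have [frS|frS] := eqVneq (fr t) S.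
    by rewrite /G' frS Sk eqxx (cell_fr_eq ct frS).
  rewrite G'lt ?EG// -ltnS -Sk; apply: proper_card.
  by rewrite finset.properEneq frS (cell_fr ct).
- move=> t; rewrite leq_eqVlt => /orP[/eqP frt|] z tz; last first.
    move: z tz; rewrite ltnS => frt z tz; rewrite G'lt//.
    by have := dG t frt z tz; rewrite lt_min => /andP[].
  have [_ _ Ed _] := hE (fl t, fr t) frt.
  rewrite /G' frt eqxx; apply: le_lt_trans (metric_triangle _ (g (fl t)) _) _.
  by rewrite [ltRHS]splitr; apply: ltrD => //; apply: fg2; exact: near_vertex_fl.
- move=> t; rewrite leq_eqVlt => /orP[/eqP frt|] gx; last first.
    by move: gx; rewrite ltnS => frt gx; rewrite G'lt// xG.
  have [_ _ _ Ex] := hE (fl t, fr t) frt.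
  by rewrite /G' frt eqxx Ex.
Qed.

Lemma grid_extension eta : 0 < eta ->
  exists2 d : R, 0 < d & forall (N : nat) g, (0 < N)%N -> fine_grid d g ->
    (forall w, (exists i, w i <= 0 \/ N%:Z <= w i) -> g w = x0) ->
    exists a : 'rV[R]_n -> X, gloop x0 a /\
      forall t z, near_vertex (N%:R *: clipv t) z -> mdist (g z) (a t) < eta.
Proof.
move=> eta0; have [d d0 hd] := skeleton_exists (leqnn n) eta0.
exists d => // N g N0 fg gout; have [G [cG dG xG]] := hd g fg.
have frn t : (#|fr t| <= n)%N by rewrite -[leqRHS]card_ord max_card.
have NR : 0 < N%:R :> R by rewrite ltr0n.
pose sc t : 'rV[R]_n := \row_i (N%:R * clip (t ord0 i)).
have scE t : sc t = N%:R *: clipv t by apply/rowP => i; rewrite !mxE.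
have csc : continuous sc by apply: cts_row => i; cts.
exists (fun t => G (sc t)); split; last first.
  by move=> t z; rewrite -scE => tz; apply: dG.
split.
  (* These top-dimensional cells form a finite closed cover of the scaled cube, so continuity on
     each is enough. *)
  pose C (z : {ffun 'I_n -> 'I_N}) : set 'rV[R]_n :=
    cell (fun i => (z i : nat)%:Z) [set: 'I_n].
  apply: (@within_cts_comp _ _ _ [set t | exists c, C c t] sc G csc).
    move=> t.
    have /fin_all_exists [z hz] i : exists a : 'I_N,
        (a : nat)%:R <= sc t ord0 i <= (a : nat)%:R + 1.
      have := clip_itv (t ord0 i); set c := clip _ => /andP[c0 c1].
      have Nc0 : 0 <= N%:R * c by rewrite mulr_ge0.
      have scc : sc t ord0 i = N%:R * c by rewrite mxE.
      have [Nc|Nc] := ltP (N%:R * c) N%:R.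
        have tr := truncn_itv Nc0.
        have lt : (Num.trunc (N%:R * c) < N)%N.
          by rewrite -(ltr_nat R); apply: le_lt_trans Nc; case/andP: tr.
        exists (Ordinal lt); rewrite scc /=.
        by move: tr; rewrite -natr1 => /andP[-> /ltW].
      (* At the right end the truncation would be [N], which indexes no cell, so the last cell is
         used. *)
      have Np : (N.-1 < N)%N by rewrite prednK.
      exists (Ordinal Np); rewrite scc /=.
      have NE : N%:R = N.-1%:R + 1 :> R by rewrite natr1 prednK.
      have : N%:R * c <= N%:R by rewrite ler_piMr// ltW.
      by rewrite [in leRHS]NE => ->; rewrite andbT; apply: le_trans Nc; rewrite NE lerDl.
    exists [ffun i => z i] => i; split; last by rewrite finset.in_setT.
    by move=> _; rewrite ffunE; exact: hz.
  apply: within_finite_closed => z; first exact: closed_cell.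
  by apply: cG; rewrite cardsT card_ord.
(* A boundary point has a coordinate equal to 0 or [N]. Being an integer, it is fixed in the
   carrier, so every vertex of the carrier has it and is sent to [x0]. *)
move=> t /out_clipv [_ [i ti]]; apply: xG => // w vw; apply: gout; exists i.
have sci : sc t ord0 i = 0 \/ sc t ord0 i = N%:R.
  by move: ti; rewrite /sc !mxE => -[->|->]; [left; rewrite mulr0|right; rewrite mulr1].
have ifr : i \notin fr (sc t).
  rewrite inE negbK; case: sci => ->; first by rewrite floor0.
  by rewrite -[N%:R]/(N%:Z%:~R) floor_int.
case: (vw i) => [->|[]]; last by rewrite (negbTE ifr).
rewrite /fl; case: sci => ->; first by left; rewrite floor0.
by right; rewrite -[N%:R]/(N%:Z%:~R) floor_int.
Qed.

End Skeleton.

(** * Small fibres for locally connected spaces *)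

Section LocallyConnected.
Context {R : realType} (X : metricType R) (x0 : X) (n : nat).

Lemma compact_cube (k : nat) : compact (@cube R k).
Proof.
rewrite (_ : cube (n := k) = [set v : 'rV[R]_k | forall i, `[0, 1]%classic (v ord0 i)]).
  apply: (@rV_compact R k (fun=> `[0, 1]%classic)) => _.
  exact: segment_compact.
by apply/seteqP; split => v cv i; have := cv i; rewrite /= in_itv.
Qed.

Lemma unif_cts_metric (T : pseudoMetricType R) (Y : metricType R) (K : set T)
    (f : T -> Y) e :
  compact K -> continuous f -> 0 < e ->
  exists2 d : R, 0 < d & forall x y, K x -> ball x d y -> mdist (f x) (f y) < e.
Proof.
move=> cK cf e0; have e2 : 0 < e / 2 by rewrite divr_gt0.
have [|d d0 hd] := @compact_uniform R T K
  (fun d x => forall y, ball x d y -> mdist (f x) (f y) < e) cK; last first.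
  by exists d => // x y Kx; exact: hd.
move=> x _.
have /nbhs_ballP [d /= d0 hd] : nbhs x [set y | mdist (f x) (f y) < e / 2].
  exact: (cf x _ (mdist_near (f x) e2)).
have d2 : 0 < d / 2 by rewrite divr_gt0.
exists (d / 2) => //.
apply/nbhs_ballP; exists (d / 2) => //=.
move=> z xz d' /andP[_ d'd] y zy.
have h1 : mdist (f x) (f z) < e / 2 by apply: hd; apply: le_ball xz; lra.
have h2 : mdist (f x) (f y) < e / 2.
  apply: hd; rewrite [d]splitr; apply: ball_triangle xz _.
  by apply: le_ball zy; exact: ltW.
by have := metric_triangle (f z) (f x) (f y); rewrite (metric_sym (f z) (f x)); lra.
Qed.

Lemma ball_row k (u v : 'rV[R]_k) d : 0 < d ->
  (forall i, `|u ord0 i - v ord0 i| < d) -> ball u d v.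
Proof. by move=> d0 uv; split => // i j; rewrite (ord1 i); exact: uv. Qed.

Lemma clip_lip (a b : R) : `|clip a - clip b| <= `|a - b|.
Proof.
have h1 := ler_norm (a - b); have h2 := ler_norm (b - a).
rewrite (distrC b a) in h2.
have cE (x : R) : (x <= 0 /\ clip x = 0) \/ (1 <= x /\ clip x = 1) \/
    (0 <= x <= 1 /\ clip x = x).
  have [xl|xl] := leP x 0; first by left; rewrite clip_le0.
  have [xg|xg] := leP 1 x; first by right; left; rewrite clip_ge1.
  by right; right; rewrite clip_id (ltW xl) (ltW xg).
by case: (cE a) => [[? ->]|[[? ->]|[/andP[? ?] ->]]];
  case: (cE b) => [[? ->]|[[? ->]|[/andP[? ?] ->]]];
  rewrite ler_norml; apply/andP; split; lra.
Qed.

Lemma LC_small_fibres : compact [set: X] -> (0 < n)%N -> @LC R n.-1 X ->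
  @small_fibres R X x0 n.
Proof.
move=> cX n0 lcX e e0.
have e3 : 0 < e / 3 by rewrite divr_gt0.
have [d d0 hd] := grid_extension x0 cX lcX e3.
(* Values at neighbouring grid points are compared through one common point, hence the division by
   2. *)
pose mesh := Num.min d (e / 3) / 2.
have mesh0 : 0 < mesh by rewrite divr_gt0// lt_min d0.
exists mesh => // m U i0 phi [_ [_ [_ Ux0]]] pouU meshU F G gF gG
  [H [cH SH H0 HF HG]].
have m0 : 0 < m%:R :> R by rewrite ltr0n; exact: leq_ltn_trans (ltn_ord i0).
pose K : set (R * 'rV[R]_n) := unit_interval `*` @cube R n.
have cK : compact K.
  apply: compact_setX; last exact: compact_cube.
  rewrite (_ : unit_interval = `[0, 1]%classic); first exact: segment_compact.
  by apply/seteqP; split => s; rewrite /= in_itv.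
(* A barycentric coordinate that is at least [1/m] at one grid point thus stays positive at its
   neighbours. *)
have [r1 r10 hr1] : exists2 r : R, 0 < r & forall p q, K p -> ball p r q ->
    forall i, `|H p ord0 i - H q ord0 i| < m%:R^-1.
  have mv0 : 0 < m%:R^-1 :> R by rewrite invr_gt0.
  have [|r r0 hr] := @compact_uniform R _ K (fun r p => forall q, ball p r q ->
    forall i, `|H p ord0 i - H q ord0 i| < m%:R^-1) cK; last first.
    by exists r => // p q Kp; exact: hr.
  move=> p _; have mv2 : 0 < m%:R^-1 / 2 :> R by rewrite divr_gt0.
  have /nbhs_ballP [r /= r0 hr] : nbhs p [set q | ball (H p) (m%:R^-1 / 2) (H q)].
    exact: (cH p _ (nbhsx_ballx _ _ mv2)).
  have r2 : 0 < r / 2 by rewrite divr_gt0.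
  exists (r / 2) => //.
  apply/nbhs_ballP; exists (r / 2) => //=.
  move=> q pq r' /andP[_ r'r] q' qq' i.
  have h1 : ball (H p) (m%:R^-1 / 2) (H q) by apply: hr; apply: le_ball pq; lra.
  have h2 : ball (H p) (m%:R^-1 / 2) (H q').
    apply: hr; rewrite [r]splitr; apply: ball_triangle pq _.
    by apply: le_ball qq'; exact: ltW.
  have := h1.2 ord0 i; have := h2.2 ord0 i; rewrite /ball /= => h3 h4.
  rewrite -(subrKA (H p ord0 i)); apply: le_lt_trans (ler_normD _ _) _.
  by rewrite distrC [ltRHS]splitr; apply: ltrD.
have [rF rF0 hrF] := unif_cts_metric (@compact_cube n) gF.1 e3.
have [rG rG0 hrG] := unif_cts_metric (@compact_cube n) gG.1 e3.
pose r := Num.min r1 (Num.min rF rG).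
have r0 : 0 < r by rewrite !lt_min r10 rF0.
(* The factor 2 matches the reach of [fine_grid]. *)
have [N N0 Nr] : exists2 N, (0 < N)%N & 2 / N%:R < r.
  have r20 : 0 <= 2 / r by rewrite divr_ge0// ltW.
  exists (Num.trunc (2 / r)).+1 => //.
  have /andP[_ h] := truncn_itv r20.
  by rewrite ltr_pdivrMr// mulrC -ltr_pdivrMr.
have NR : 0 < N%:R :> R by rewrite ltr0n.
have [/andP[Nr1 NrF] NrG] : (2 / N%:R < r1) && (2 / N%:R < rF) /\ 2 / N%:R < rG.
  by move: Nr; rewrite !lt_min => /andP[-> /andP[-> ->]].
pose pt (z : 'I_n -> int) : 'rV[R]_n := \row_i ((z i)%:~R / N%:R).
have Hclip s t : H (s, clipv t) = H (s, t).
  have [ot|/not_out ct] := pselect (out t); last by rewrite clipv_id.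
  by rewrite !H0//; apply/out_boundary/out_clipv.
pose HH (k : nat) z := H (k%:R / N%:R, pt z).
have HHdiff (k k' : nat) z z' : (k <= N)%N -> (k' <= N)%N ->
    `|k%:R - k'%:R| <= 1 :> R -> (forall i, `|z i - z' i| <= 2) ->
    forall i, `|HH k z ord0 i - HH k' z' ord0 i| < m%:R^-1.
  move=> kN k'N kk zz i; rewrite /HH -[H (_, pt z)]Hclip -[H (_, pt z')]Hclip.
  apply: hr1.
    split; last exact: cube_clipv.
    rewrite /unit_interval /= divr_ge0//= ler_pdivrMr// mul1r ler_nat//.
  split => /=.
    rewrite /ball /= -mulrBl normrM normfV (ger0_norm (ltW NR)).
    by apply: le_lt_trans Nr1; rewrite ler_pM2r ?invr_gt0//; lra.
  apply: ball_row => // j; rewrite !mxE.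
  apply: le_lt_trans (clip_lip _ _) _; apply: le_lt_trans Nr1.
  rewrite -mulrBl normrM normfV (ger0_norm (ltW NR)) ler_pM2r ?invr_gt0//.
  by rewrite -intrB -intr_norm -[2]/(2%:~R) ler_int.
(* Of [m] coordinates with sum 1 one is at least [1/m]; a point of the corresponding member is
   taken. The prescribed values are admissible: on the end slices [H] is the image of [F] or [G],
   and off the open cube it is the vertex [i0], which forces the index [i0]. *)
have [gi hgi] : exists gi : nat * ('I_n -> int) -> X * 'I_m, forall p,
  [/\ m%:R^-1 <= HH p.1 p.2 ord0 (gi p).2, U (gi p).2 (gi p).1,
      out (pt p.2) -> (gi p).1 = x0,
      p.1 = 0 -> (gi p).1 = F (pt p.2) & p.1 = N -> (gi p).1 = G (pt p.2)].
  apply: (@dep_choice _ (fun=> (X * 'I_m)%type)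
    (fun (p : nat * ('I_n -> int)) (q : X * 'I_m) =>
      [/\ m%:R^-1 <= HH p.1 p.2 ord0 q.2, U q.2 q.1,
      out (pt p.2) -> q.1 = x0,
      p.1 = 0 -> q.1 = F (pt p.2) & p.1 = N -> q.1 = G (pt p.2)])).
  move=> [k z] /=.
  have [h0 [h1 [_ [x hx]]]] := SH (k%:R / N%:R, pt z).
  have [i hi] : exists i, m%:R^-1 <= HH k z ord0 i.
    apply: contrapT => hn; have : \sum_i HH k z ord0 i < 1; last by rewrite h1 ltxx.
    have -> : 1 = \sum_(i < m) m%:R^-1 :> R.
      by rewrite sumr_const card_ord -[RHS]mulr_natl divff// gt_eqF.
    apply: ltr_sum => //; first by apply/hasP; exists i0; rewrite ?mem_index_enum.
    by move=> i _; rewrite ltNge; apply/negP => hi; apply: hn; exists i.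
  have hi0 : 0 < HH k z ord0 i by apply: lt_le_trans hi; rewrite invr_gt0.
  have [k0|/eqP kn0] := eqVneq k 0%N.
    have UF : U i (F (pt z)).
      by apply: (pou_support pouU); move: hi0; rewrite /HH k0 mul0r HF mxE.
    exists (F (pt z), i); split => /=; [exact: hi|exact: UF|exact: gF.2|by []|].
    by move=> kN; move: N0; rewrite -kN k0.
  have [kN|/eqP knN] := eqVneq k N.
    have UG : U i (G (pt z)).
      apply: (pou_support pouU); move: hi0.
      by rewrite /HH kN divff ?gt_eqF// HG mxE.
    by exists (G (pt z), i); split => /=; [exact: hi|exact: UG|exact: gG.2|move/kn0|].
  have [ot|nt] := pselect (out (pt z)).
    have ii0 : i = i0.
      by move: hi0; rewrite /HH H0// mxE; case: eqP => // _; rewrite ltxx.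
    exists (x0, i); split => /=; [exact: hi|by rewrite ii0|by []| |].
      by move/kn0.
    by move/knN.
  exists (x, i); split => /=; [exact: hi| |by []|by move/kn0|by move/knN].
  by apply: hx; rewrite inE.
pose g k z := (gi (k, z)).1.
have gdist k k' z z' : (k <= N)%N -> (k' <= N)%N ->
    `|k%:R - k'%:R| <= 1 :> R -> (forall i, `|z i - z' i| <= 2) ->
    mdist (g k z) (g k' z') < Num.min d (e / 3).
  move=> kN k'N kk zz.
  have [hi Ui _ _ _] := hgi (k, z); have [hi' Ui' _ _ _] := hgi (k', z').
  (* [x] lies in all members of the support at [(k, z)]. The member chosen at [(k', z')] is among
     them, since its coordinate at [(k, z)] exceeds [1/m - 1/m = 0]. *)
  have [_ [_ [_ [x hx]]]] := SH (k%:R / N%:R, pt z).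
  have Ux : U (gi (k, z)).2 x.
    by apply: hx; rewrite inE; apply: lt_le_trans hi; rewrite invr_gt0.
  have Ux' : U (gi (k', z')).2 x.
    apply: hx; rewrite inE.
    have := HHdiff k k' z z' kN k'N kk zz (gi (k', z')).2.
    by rewrite ltr_norml => /andP[h _]; move: hi' h; rewrite /HH /=; lra.
  have := meshU _ _ _ Ui Ux; have := meshU _ _ _ Ux' Ui'.
  by have := metric_triangle (g k z) x (g k' z'); rewrite /g /mesh; lra.
have gfine k : (k <= N)%N -> fine_grid d (g k).
  move=> kN z w zw; have := gdist k k z w kN kN _ zw.
  by rewrite subrr normr0 ler01 lt_min => /(_ isT)/andP[].
have gout k w : (exists i, w i <= 0 \/ N%:Z <= w i) -> g k w = x0.
  move=> [i wi]; have [_ _ ho _ _] := hgi (k, w); apply: ho; exists i.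
  rewrite mxE; case: wi => wi; [left|right].
    by rewrite pmulr_lle0 ?invr_gt0// -[0]/(0%:~R) ler_int.
  by rewrite ler_pdivlMr// mul1r -[N%:R]/(N%:Z%:~R) ler_int.
have [a ha] : exists a : nat -> 'rV[R]_n -> X, forall k, (k <= N)%N ->
    gloop x0 (a k) /\
    forall t z, near_vertex (N%:R *: clipv t) z -> mdist (g k z) (a k t) < e / 3.
  apply: (@dep_choice _ (fun=> 'rV[R]_n -> X) (fun k ak => (k <= N)%N ->
    gloop x0 ak /\
    forall t z, near_vertex (N%:R *: clipv t) z -> mdist (g k z) (ak t) < e / 3)).
  move=> k; have [kN|kN] := leqP k N; last first.
    by exists (fun=> x0).
  by have [ak hak] := hd N (g k) N0 (gfine k kN) (gout k); exists ak.
pose z0 (t : 'rV[R]_n) := fl (N%:R *: clipv t).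
have z0near t : near_vertex (N%:R *: clipv t) (z0 t) := cell_near (cell_fl _).
have z0pt t : ball (clipv t) (2 / N%:R) (pt (z0 t)).
  apply: ball_row; first by rewrite divr_gt0.
  move=> i; have := floor_le_lt ((N%:R *: clipv t) ord0 i).
  rewrite /pt /z0 /fl !mxE; set c := clip _; set f := Num.floor _ => /andP[h1 h2].
  rewrite -[c](mulfK (lt0r_neq0 NR)) -mulrBl normrM normfV (ger0_norm (ltW NR)).
  by rewrite ltr_pM2r ?invr_gt0// ltr_norml; apply/andP; split; lra.
(* On an end slice the grid values sample the loop itself, so the loop and the extension both stay
   near the value at [z0 t]. *)
have endF (F' : 'rV[R]_n -> X) k : (k <= N)%N -> gloop x0 F' ->
    (forall z, g k z = F' (pt z)) ->
    (forall x y, cube x -> ball x (2 / N%:R) y -> mdist (F' x) (F' y) < e / 3) ->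
    @close R X x0 n e F' (a k).
  move=> kN gF' gk cF'; have [gak hak] := ha k kN.
  apply: close_pt => // t; rewrite -(gloop_clipv t gF').
  have := cF' _ _ (cube_clipv t) (z0pt t); have := hak t _ (z0near t).
  rewrite gk; have := metric_triangle (F' (clipv t)) (F' (pt (z0 t))) (a k t); lra.
have clF : @close R X x0 n e F (a 0%N).
  apply: endF => // [z|x y cx xy]; first by have [_ _ _ h _] := hgi (0%N, z); exact: h.
  by apply: hrF => //; apply: le_ball xy; exact: ltW.
have clG : @close R X x0 n e G (a N).
  apply: endF => // [z|x y cx xy]; first by have [_ _ _ _ h] := hgi (N, z); exact: h.
  by apply: hrG => //; apply: le_ball xy; exact: ltW.
apply: (close_trans n0 _ (close_sym clG)).
(* Closeness is carried from slice to slice; neighbouring extensions are compared at the vertex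
   [z0 t]. *)
suff : forall k, (k <= N)%N -> @close R X x0 n e F (a k) by apply.
elim=> [//|k IH] kN; apply: (close_trans n0 (IH (ltnW kN))).
have [gk hk] := ha k (ltnW kN); have [gk1 hk1] := ha k.+1 kN.
apply: close_pt => // t.
have h1 := hk t _ (z0near t); have h2 := hk1 t _ (z0near t).
have : mdist (g k (z0 t)) (g k.+1 (z0 t)) < Num.min d (e / 3).
  apply: gdist => //; first exact: ltnW.
    by rewrite -natr1 opprD addrA subrr add0r normrN normr1.
  by move=> i; rewrite subrr normr0.
rewrite lt_min => /andP[_ h3].
have := metric_triangle (a k t) (g k (z0 t)) (a k.+1 t).
have := metric_triangle (g k (z0 t)) (g k.+1 (z0 t)) (a k.+1 t).
by rewrite (metric_sym (a k t) (g k (z0 t))); lra.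
Qed.

End LocallyConnected.

(** * Comparison of the two topologies *)

Unset Implicit Arguments.

Theorem theorem1p1 (R : realType) (X : metricType R) (x0 : X) (n : nat) :
  compact [set: X] -> @path_connected R X -> (0 < n)%N ->
  (forall A : set (@pin R X x0 n), shape_open A -> rho_open A) /\
  (@LC R (n.-1) X \/ @inv_limit_retract_polyhedra R X ->
   forall A : set (@pin R X x0 n), shape_open A <-> rho_open A).
Proof.
move=> cX pX n0; split=> [A|hX A]; first exact: shape_open_rho_open.
split; first exact: shape_open_rho_open.
apply: small_fibres_shape_open => //.
by case: hX => hX; [exact: LC_small_fibres|exact: retract_small_fibres].
Qed.
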